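(* There exist a continuous, even, concave deterministic function $\Lambda:[-1,1]\to[0,\infty)$ and an event $\Omega_0$ with $\mathbb P(\Omega_0)=1$ such that for every realization $(B,F)\in\Omega_0$ and every $\alpha\in[-1,1]$, \[ \lim_{n\to\infty}\frac{\bar A(B,F;n,[\alpha n])}{n}=-\Lambda(\alpha). \]
   Context: Let $c>0$, $q>0$, $\kappa>-1$. On a probability space $(\Omega,\mathcal F,\mathbb P)$ let $F=(F(x))_{x\in\mathbb Z}$ and $B=(B(i))_{i\in\mathbb Z}$ be two mutually independent families of i.i.d. random variables, with $\mathbb P(B(i)=1)=\mathbb P(B(i)=-1)=1/2$, and $F(x)$ having a density $\varrho$ which is even, continuous and strictly positive on $(-c,c)$, vanishes outside $(-c,c)$, and satisfies $\lim_{x\to c}\varrho(x)/|c-x|^{\kappa}=q$. For integers $x_1,x_2$ and $0\le t_1\le t_2$, $\Gamma((t_1,x_1);(t_2,x_2))$ is the set of lazy walks $\gamma:\{t_1,\dots,t_2\}\to\mathbb Z$ with $\gamma(t_1)=x_1$, $\gamma(t_2)=x_2$, $|\gamma(i+1)-\gamma(i)|\le1$. For $b:\mathbb Z\to\{\pm1\}$, $f:\mathbb Z\to[-c,c]$, the action is $A(b,f;\gamma)=\sum_{i=t_1+1}^{t_2}b(i)f(\gamma(i))$, and $\bar A(b,f;(t_1,x_1),(t_2,x_2))=\min_{\gamma\in\Gamma((t_1,x_1);(t_2,x_2))}A(b,f;\gamma)$; $\bar A(b,f;t,x)$ abbreviates $\bar A(b,f;(0,0),(t,x))$. The integer part $[x]$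 rounds towards $0$: $[x]=\lfloor x\rfloor$ for $x\ge0$, $[x]=-\lfloor -x\rfloor$ for $x<0$. *)

(* Defs.v *)
From HB Require Import structures.
From mathcomp Require Import all_boot all_order all_algebra.
From mathcomp Require Import all_classical all_reals all_analysis.
Set Implicit Arguments. Unset Strict Implicit. Unset Printing Implicit Defensive.
Import Order.TTheory GRing.Theory Num.Theory.
Import numFieldNormedType.Exports.
Local Open Scope classical_set_scope.
Local Open Scope ring_scope.

Definition intpart {R : realType} (x : R) : int :=
  if 0 <= x then Num.floor x else - Num.floor (- x).

(* lazy walks gamma : {0,...,t} -> Z, started at (0,0) and ending at (t,x);
   values of gamma beyond t are irrelevant. *)
Definition lazy_walk (t : nat) (x : int) (g : nat -> int) : Prop :=
  g 0%N = 0 /\ g t = x /\ (forall i, (i < t)%N -> `|g i.+1 - g i| <= 1).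

Definition action {R : realType} (b f : int -> R) (t : nat) (g : nat -> int) : R :=
  \sum_(1 <= i < t.+1) b (i%:Z) * f (g i).

Definition Abar {R : realType} (b f : int -> R) (t : nat) (x : int) : R :=
  inf [set action b f t g | g in lazy_walk t x].

Definition FB_family {T R : Type} (F B : int -> T -> R) (k : int + int) : T -> R :=
  match k with inl x => F x | inr i => B i end.

Definition mutually_independent {d} {T : measurableType d} {R : realType}
  {I : eqType} (P : probability T R) (X : I -> T -> R) : Prop :=
  forall (s : seq I) (A : I -> set R), uniq s ->
    (forall k, measurable (A k)) ->
    P (\big[setI/setT]_(k <- s) ((X k) @^-1` A k)) =
    (\prod_(k <- s) P ((X k) @^-1` A k))%E.

(* Main.v *)
(* The random field [B i * F x] is bounded and its law is invariant under space-time shifts, so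
   for a fixed rational direction [(n, m)] the minimal costs between the points [(i n, i m)] form a
   stationary subadditive process.  When [m != 0], blocks that are far apart use disjoint parts of
   both [B] and [F] and are therefore independent: an [L^2] law of large numbers for the blocks
   bounds the upper limit by the infimum [g] of the mean rates, and the tiling argument of
   Katznelson and Weiss shows that the lower limit is at least [g].  (For [m = 0] the shift does
   not move [F] and ergodicity fails.)  Since a walk may be prolonged by any lazy walk at bounded
   cost per step, the rates in the directions with [m != 0] already determine the limit at every
   slope in [(-1, 1)], slope [0] included, together with its continuity there.  At the slopes [1]
   and [-1] there is a single walk, whose mean cost is [0] by the symmetry of [B].  Evenness comes
   from the reflection of [F], concavity from subadditivity of the means, and continuity at the
   endpoints from an exponential moment bound on the partition function, obtained by flipping the
   coins [B i] one at a time. *)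

Require Import Defs.
From HB Require Import structures.
From mathcomp Require Import all_boot all_order all_algebra.
From mathcomp Require Import all_classical all_reals all_analysis.
From mathcomp Require Import measurable_realfun.
From mathcomp Require Import ring lra zify.
Import Order.TTheory GRing.Theory Num.Theory.
Import numFieldNormedType.Exports.
Local Open Scope classical_set_scope.
Local Open Scope ring_scope.
Set Implicit Arguments.
Unset Strict Implicit.
Unset Printing Implicit Defensive.

(** * Minimal costs of lazy walks *)

Section LastPassage.
Context {R : realType}.
Implicit Types (v : nat -> int -> R) (g : nat -> int).

(** Two obstacles shape the proof. First, no shift acts on the given probability space, so
    stationarity and independence are available only through laws: functionals are moved to a space
    of coordinate families, whose law is determined by finite cylinders, and shift invariance of an
    event is replaced by a decreasing sequence of events of equal probability. Second, the
    exceptional null set must not depend on the slope: only countably many rational directions are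
    treated almost surely, and [directional_rate] builds from their rates one function that governs
    every family of costs with these rates. The mean costs and the costs in almost every environment
    thus share it, so evenness and concavity need only be proved for means. The slopes 1 and -1
    escape this: a walk there has no spare time, so the comparison degenerates, and concavity alone
    would allow a drop at an endpoint. A first moment of the partition function excludes it, because
    few walks have slope near 1 and the mean weight of each is controlled by hyperbolic cosines. *)

Definition walk_cost v (t : nat) g : R := \sum_(1 <= i < t.+1) v i (g i).

Definition min_cost v (t : nat) (x : int) : R :=
  inf [set walk_cost v t g | g in lazy_walk t x].

Definition shift_field (s : nat) (x : int) v : nat -> int -> R :=
  fun i y => v (s + i)%N (x + y).

Definition field_bounded (c : R) v := forall i x, `|v i x| <= c.

Lemma shift_field_bounded c s x v : field_bounded c v ->
  field_bounded c (shift_field s x v).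
Proof. by move=> vc i y; exact: vc. Qed.

Lemma lazy_walk_exists (t : nat) (x : int) : `|x| <= t%:Z ->
  exists g, lazy_walk t x g.
Proof.
move=> xt; exists (fun i => if 0 <= x then (minn i `|x|%N)%:Z
                            else - (minn i `|x|%N)%:Z).
by split; [|split=> [|i it]]; case: ifPn => x0; lia.
Qed.

Lemma lazy_walk_le t x g : lazy_walk t x g -> forall i, (i <= t)%N -> `|g i| <= i%:Z.
Proof.
move=> [g0 [_ gS]]; elim=> [|i IH] it; first by rewrite g0.
by have := IH (ltnW it); have := gS _ it; lia.
Qed.

Lemma lazy_walk_cat s x t y g h : lazy_walk s x g -> lazy_walk t y h ->
  lazy_walk (s + t)%N (x + y) (fun i => if (i <= s)%N then g i else x + h (i - s)%N).
Proof.
move=> [g0 [gs gS]] [h0 [ht hS]]; split; first by rewrite g0.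
split.
  case: ifPn => [ts|_]; last by rewrite addKn ht.
  have t0 : t = 0%N by lia.
  by move: ht; rewrite t0 h0 addn0 gs => <-; rewrite addr0.
move=> i; case: (ltngtP i s) => [is_ _|si ist|-> ist].
- by apply: gS.
- have -> : (i.+1 - s)%N = (i - s).+1 by lia.
  have := hS (i - s)%N; have : (i - s < t)%N by lia.
  by move=> -> /(_ isT); lia.
- have -> : (s.+1 - s)%N = 1%N by lia.
  have := hS 0%N; rewrite h0 => /(_ ltac:(lia)); rewrite gs; lia.
Qed.

Lemma walk_cost_cat v s x t g h :
  walk_cost v (s + t) (fun i => if (i <= s)%N then g i else x + h (i - s)%N) =
  walk_cost v s g + walk_cost (shift_field s x v) t h.
Proof.
rewrite /walk_cost (@big_cat_nat _ _ _ s.+1) //=; last by lia.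
congr (_ + _).
  by apply: eq_big_nat => i /andP[_ is_]; rewrite (_ : (i <= s)%N)//; lia.
rewrite -{1}(add1n s) big_addn (_ : ((s + t).+1 - s)%N = t.+1); last by lia.
apply: eq_big_nat => i /andP[i1 _].
by rewrite (_ : (i + s <= s)%N = false) ?addnK ?[(i + s)%N]addnC//; lia.
Qed.

Lemma walk_cost_bounded c v : field_bounded c v -> forall t g,
  `|walk_cost v t g| <= c * t%:R.
Proof.
move=> vc t g; apply: (le_trans (ler_norm_sum _ _ _)).
apply: (@le_trans _ _ (\sum_(1 <= i < t.+1) c)); first exact: ler_sum.
by rewrite sumr_const_nat subn1 mulr_natr.
Qed.

Section Bounded.
Variables (c : R) (v : nat -> int -> R) (vc : field_bounded c v).

Lemma min_cost_le t x g : lazy_walk t x g -> min_cost v t x <= walk_cost v t g.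
Proof.
move=> gw; apply: ge_inf; last by exists g.
exists (- (c * t%:R)) => _ [h _ <-].
by have := walk_cost_bounded vc t h; rewrite ler_norml => /andP[].
Qed.

(** The bound on [x] guarantees that some walk exists: the infimum of the empty set is 0 by default,
    and 0 need not exceed [r]. *)
Lemma le_min_cost t x r : `|x| <= t%:Z ->
  (forall g, lazy_walk t x g -> r <= walk_cost v t g) -> r <= min_cost v t x.
Proof.
move=> /lazy_walk_exists[g gw] rv; apply: lb_le_inf; first by exists (walk_cost v t g), g.
by move=> _ [h hw <-]; exact: rv.
Qed.

Lemma min_cost_norm t x : `|x| <= t%:Z -> `|min_cost v t x| <= c * t%:R.
Proof.
move=> xt; have [g gw] := lazy_walk_exists xt; rewrite ler_norml; apply/andP; split.
  by apply: le_min_cost => // h _;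
     have := walk_cost_bounded vc t h; rewrite ler_norml => /andP[].
apply: (le_trans (min_cost_le gw)).
by have := walk_cost_bounded vc t g; rewrite ler_norml => /andP[].
Qed.
End Bounded.

Lemma min_cost_subadditive c v s x t y : field_bounded c v ->
  `|x| <= s%:Z -> `|y| <= t%:Z ->
  min_cost v (s + t) (x + y) <=
  min_cost v s x + min_cost (shift_field s x v) t y.
Proof.
move=> vc xs yt; rewrite -lerBlDr.
apply: le_min_cost xs _ => g gw; rewrite lerBlDr -lerBlDl.
apply: le_min_cost yt _ => h hw; rewrite lerBlDl -walk_cost_cat.
by apply: (min_cost_le vc); exact: lazy_walk_cat.
Qed.

(** The cost reads the field only at times 1 to [t] and inside the cone of reachable sites; this
    locality later turns distance between blocks into independence. *)
Lemma eq_min_cost v v' t x :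
  (forall i y, (1 <= i <= t)%N -> `|y| <= i%:Z -> v i y = v' i y) ->
  min_cost v t x = min_cost v' t x.
Proof.
move=> vv'; congr inf; apply: eq_imagel => g gw.
apply: eq_big_nat => i /andP[i1 it]; apply: vv'; rewrite ?i1//.
exact: lazy_walk_le gw _ _.
Qed.

Lemma min_cost_reflect v t x :
  min_cost (fun i y => v i (- y)) t x = min_cost v t (- x).
Proof.
have opp u y g : lazy_walk u y g -> lazy_walk u (- y) (fun i => - g i).
  by move=> [g0 [gu gS]]; rewrite /lazy_walk g0 gu; do 2!split=> //; move=> i /gS; lia.
congr inf; apply/seteqP; split=> _ [g gw <-].
  by exists (fun i => - g i); first exact: opp.
exists (fun i => - g i); first by rewrite -[x]opprK; exact: opp.
by apply: eq_bigr => i _; rewrite opprK.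
Qed.

Lemma min_cost_diag v t : min_cost v t t%:Z = \sum_(1 <= i < t.+1) v i i%:Z.
Proof.
have diag g : lazy_walk t t%:Z g -> forall i, (i <= t)%N -> g i = i%:Z.
  move=> gw i it; have := lazy_walk_le gw it; case: gw => _ [gt gS].
  have step k : (i + k <= t)%N -> g (i + k)%N - g i <= k%:Z.
    elim: k => [|k IH] ikt; first by rewrite addn0 subrr.
    by have := IH ltac:(lia); have := gS (i + k)%N ltac:(lia); rewrite addnS; lia.
  have := step (t - i)%N; rewrite subnKC// gt => /(_ (leqnn t)); lia.
rewrite /min_cost (_ : [set _ | _ in _] = [set \sum_(1 <= i < t.+1) v i i%:Z]) ?inf1//.
apply/seteqP; split=> [_ [g gw <-]|_ ->].
  by apply: eq_big_nat => i /andP[_ it]; rewrite diag.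
exists (fun i => i%:Z) => //; split=> //; split=> // i _; lia.
Qed.

(** Partition function of the directed polymer at inverse temperature [th]: the weights
    [expR (- th * cost)] summed over all lazy walks from the origin to [(t, x)]. The recursion on
    the last step isolates the coin of the last time, the one that the moment bound flips. *)
Fixpoint partition_fun (th : R) v (t : nat) (x : int) : R :=
  if t is s.+1 then
    expR (- th * v t x) * (partition_fun th v s (x - 1) + partition_fun th v s x +
                           partition_fun th v s (x + 1))
  else (x == 0)%:R.

Lemma partition_fun_ge0 th v t x : 0 <= partition_fun th v t x.
Proof.
elim: t x => [|t IH] x /=; first exact: ler0n.
by rewrite mulr_ge0 ?expR_ge0// !addr_ge0.
Qed.

Lemma eq_partition_fun th v v' t : (forall i y, (1 <= i <= t)%N -> v i y = v' i y) ->
  forall x, partition_fun th v t x = partition_fun th v' t x.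
Proof.
elim: t => [//|t IH] vv' x; rewrite /= vv' ?leqnn// !IH// => i y /andP[i1 it].
all: by rewrite vv'// i1 ltnW.
Qed.

Lemma partition_fun_ge th v t x g : lazy_walk t x g ->
  expR (- th * walk_cost v t g) <= partition_fun th v t x.
Proof.
elim: t x => [|t IH] x [g0 [gt gS]] /=.
  by rewrite -gt g0 eqxx /walk_cost big_geq// mulr0 expR0.
have {}IH := IH (g t) (conj g0 (conj erefl (fun i it => gS i (ltnW it)))).
rewrite /walk_cost big_nat_recr//= mulrDr expRD mulrC gt ler_pM2l ?expR_gt0//.
apply: (le_trans IH).
have := partition_fun_ge0 th v t (x - 1); have := partition_fun_ge0 th v t x.
have := partition_fun_ge0 th v t (x + 1).
have := gS t (ltnSn t); rewrite gt => gx.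
have [->|[->|->]] : g t = x - 1 \/ g t = x \/ g t = x + 1 by lia.
all: by lra.
Qed.

End LastPassage.

(** * Expectations and laws on coordinate spaces *)

(** This class is closed under sums, products and measurable substitutions and is integrable for
    every probability, so it settles the side conditions on expectations. *)
Definition bounded_measurable {d} {T : measurableType d} {R : realType} (f : T -> R) :=
  measurable_fun setT f /\ exists M, forall x, `|f x| <= M.

Section BoundedMeasurable.
Context {d} {T : measurableType d} {R : realType}.
Implicit Types f g : T -> R.

Lemma bounded_measurable_cst (r : R) : bounded_measurable (fun _ : T => r).
Proof. by split; [exact: measurable_cst | exists `|r|]. Qed.

Lemma bounded_measurableD f g : bounded_measurable f -> bounded_measurable g ->
  bounded_measurable (fun x => f x + g x).
Proof.
move=> [mf [M fM]] [mg [N gN]]; split; first exact: measurable_funD.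
by exists (M + N) => x; rewrite (le_trans (ler_normD _ _))// lerD.
Qed.

Lemma bounded_measurableM f g : bounded_measurable f -> bounded_measurable g ->
  bounded_measurable (fun x => f x * g x).
Proof.
move=> [mf [M fM]] [mg [N gN]]; split; first exact: measurable_funM.
by exists (M * N) => x; rewrite normrM ler_pM.
Qed.

Lemma bounded_measurableZ (r : R) f : bounded_measurable f ->
  bounded_measurable (fun x => r * f x).
Proof. exact/bounded_measurableM/bounded_measurable_cst. Qed.

Lemma bounded_measurableB f g : bounded_measurable f -> bounded_measurable g ->
  bounded_measurable (fun x => f x - g x).
Proof.
move=> mf /(bounded_measurableZ (-1)) mg.
by under eq_fun do rewrite -mulN1r; exact: bounded_measurableD.
Qed.

Lemma bounded_measurable_norm f : bounded_measurable f ->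
  bounded_measurable (fun x => `|f x|).
Proof.
move=> [mf [M fM]]; split; first exact: measurableT_comp.
by exists M => x; rewrite normr_id.
Qed.

Lemma bounded_measurable_indic (A : set T) : measurable A ->
  bounded_measurable (\1_A : T -> R).
Proof.
move=> mA; split; first exact: measurable_indic.
by exists 1 => x; rewrite indicE normr_nat lern1 leq_b1.
Qed.

Lemma bounded_measurable_sum (I : Type) (s : seq I) (f_ : I -> T -> R) :
  (forall i, bounded_measurable (f_ i)) ->
  bounded_measurable (fun x => \sum_(i <- s) f_ i x).
Proof.
move=> mf; elim: s => [|i s IH].
  by under eq_fun do rewrite big_nil; exact: bounded_measurable_cst.
by under eq_fun do rewrite big_cons; exact: bounded_measurableD.
Qed.

Lemma bounded_measurable_comp d' (T' : measurableType d') (X : T' -> T) f :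
  measurable_fun setT X -> bounded_measurable f -> bounded_measurable (f \o X).
Proof.
by move=> mX [mf [M fM]]; split; [exact: measurableT_comp | exists M => x; exact: fM].
Qed.

Variable P : probability T R.

Lemma bounded_measurable_integrable (A : set T) f : measurable A ->
  bounded_measurable f -> P.-integrable A (EFin \o f).
Proof.
move=> mA [mf [M fM]]; apply: measurable_bounded_integrable => //.
- by rewrite (le_lt_trans (probability_le1 P mA))// ltry.
- exact: measurable_funTS.
- by exists M; split; [exact: num_real | move=> x Mx y _; exact: le_trans (fM y) (ltW Mx)].
Qed.
Hint Resolve bounded_measurable_integrable : core.

Lemma expect_cst (r : R) : \int[P]_x r = r.
Proof. by rewrite Rintegral_cst// (_ : fine _ = 1) ?mulr1//= probability_setT. Qed.

Lemma expectD f g : bounded_measurable f -> bounded_measurable g ->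
  \int[P]_x (f x + g x) = \int[P]_x f x + \int[P]_x g x.
Proof. by move=> mf mg; rewrite RintegralD//; exact: bounded_measurable_integrable. Qed.

Lemma expectZ (r : R) f : bounded_measurable f ->
  \int[P]_x (r * f x) = r * \int[P]_x f x.
Proof. by move=> mf; rewrite RintegralZl//; exact: bounded_measurable_integrable. Qed.

Lemma expectB f g : bounded_measurable f -> bounded_measurable g ->
  \int[P]_x (f x - g x) = \int[P]_x f x - \int[P]_x g x.
Proof. by move=> mf mg; rewrite RintegralB//; exact: bounded_measurable_integrable. Qed.

Lemma expect_le f g : bounded_measurable f -> bounded_measurable g ->
  (forall x, f x <= g x) -> \int[P]_x f x <= \int[P]_x g x.
Proof. by move=> mf mg fg; apply: le_Rintegral => //; exact: bounded_measurable_integrable. Qed.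

Lemma expect_sum (I : Type) (s : seq I) (f_ : I -> T -> R) :
  (forall i, bounded_measurable (f_ i)) ->
  \int[P]_x (\sum_(i <- s) f_ i x) = \sum_(i <- s) \int[P]_x f_ i x.
Proof.
move=> mf; elim: s => [|i s IH].
  by under eq_Rintegral do rewrite big_nil; rewrite big_nil expect_cst.
under eq_Rintegral do rewrite big_cons.
by rewrite big_cons expectD ?IH//; exact: bounded_measurable_sum.
Qed.

Lemma expect_indic (A : set T) : measurable A -> \int[P]_x \1_A x = fine (P A).
Proof. by move=> mA; rewrite /Rintegral integral_indic ?setIT. Qed.

End BoundedMeasurable.

(** * Laws of families of real random variables *)

Section CoordinateSpace.
Context {I : choiceType} {R : realType}.

Definition cylinder (s : seq I) (A : I -> set R) : set (I -> R) :=
  [set w | forall k, k \in s -> A k (w k)].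

Definition cylinders : set (set (I -> R)) :=
  [set C | exists s A, [/\ uniq s, forall k, measurable (A k) & C = cylinder s A]].

(** The product sigma-algebra, presented by the pi-system of finite cylinders because mutual
    independence is stated for finite lists of indices. *)
Definition coord_space := g_sigma_algebraType cylinders.

Lemma setI_closed_cylinders : setI_closed cylinders.
Proof.
move=> _ _ [s [A [_ mA ->]]] [s' [A' [_ mA' ->]]].
exists (undup (s ++ s')), (fun k => (if k \in s then A k else setT) `&`
                             (if k \in s' then A' k else setT)); split.
- exact: undup_uniq.
- by move=> k; apply: measurableI; case: ifP.
apply/seteqP; split => w /=.
  by move=> [sA sA'] k _; split; case: ifPn => // ks; [exact: sA | exact: sA'].
move=> h; split=> k ks.
- by have := h k; rewrite mem_undup mem_cat ks => /(_ isT)[].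
- by have := h k; rewrite mem_undup mem_cat ks orbT => /(_ isT)[_].
Qed.

Lemma measurable_coord (k : I) : measurable_fun setT (fun w : coord_space => w k).
Proof.
move=> _ A mA; rewrite setTI; apply: sub_sigma_algebra.
exists [:: k], (fun=> A); split => //; apply/seteqP; split=> w /=.
  by move=> Aw k'; rewrite inE => /eqP ->.
by apply; rewrite inE.
Qed.

Lemma cylinder_cons k s A :
  cylinder (k :: s) A = (fun w => w k) @^-1` A k `&` cylinder s A.
Proof.
apply/seteqP; split=> w /=.
  by move=> h; split=> [|k' k's]; apply: h; rewrite inE ?eqxx// k's orbT.
by move=> [h h'] k'; rewrite inE => /orP[/eqP ->|/h'].
Qed.

Lemma cylinder_nil A : cylinder [::] A = setT.
Proof. by apply/seteqP. Qed.

Lemma preimage_cylinder (U : Type) (X : U -> I -> R) s A :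
  X @^-1` cylinder s A = \big[setI/setT]_(k <- s) ((fun u => X u k) @^-1` A k).
Proof.
elim: s => [|k s IH]; first by rewrite big_nil cylinder_nil.
by rewrite big_cons cylinder_cons preimage_setI IH.
Qed.

Lemma measurable_fun_coord_space d (T : measurableType d) (X : T -> coord_space) :
  (forall k, measurable_fun setT (fun u => X u k)) -> measurable_fun setT X.
Proof.
move=> mX; apply: (@measurability _ _ T coord_space setT X cylinders) => //.
move=> _ [_ [s [A [_ mA ->]]] <-]; rewrite setTI preimage_cylinder.
by apply: bigsetI_measurable => k _; rewrite -[X in measurable X]setTI; exact: mX.
Qed.

Section Law.
Context d1 d2 (T1 : measurableType d1) (T2 : measurableType d2).
Variables (P1 : probability T1 R) (P2 : probability T2 R).
Variables (X1 : T1 -> coord_space) (X2 : T2 -> coord_space).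
Hypotheses (mX1 : measurable_fun setT X1) (mX2 : measurable_fun setT X2).
Hypothesis X12 : forall s A, uniq s -> (forall k, measurable (A k)) ->
  P1 (X1 @^-1` cylinder s A) = P2 (X2 @^-1` cylinder s A).

Let m1 := measure_function_pushforward__canonical__measure_function_Measure P1 mX1.
Let m2 := measure_function_pushforward__canonical__measure_function_Measure P2 mX2.

Lemma law_unique (U : set coord_space) : measurable U -> P1 (X1 @^-1` U) = P2 (X2 @^-1` U).
Proof.
move=> mU.
have cT : [set: I -> R] = cylinder [::] (fun=> setT) by rewrite cylinder_nil.
apply: (@measure_unique _ _ coord_space cylinders (fun=> setT) _ _ _ _ m1 m2) => //.
- exact: setI_closed_cylinders.
- by move=> _; exists [::], (fun=> setT).
- by apply: bigcup_const; exists 0%N.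
- by move=> _ [s [A [us mA ->]]]; exact: X12.
- by move=> k; rewrite /m1/= /pushforward preimage_setT probability_setT ltry.
Qed.

Lemma law_unique_expect (f : coord_space -> R) : bounded_measurable f ->
  \int[P1]_x f (X1 x) = \int[P2]_x f (X2 x).
Proof.
move=> mf; congr fine.
transitivity (\int[m1]_x (f x)%:E)%E; last transitivity (\int[m2]_x (f x)%:E)%E.
- rewrite (integral_pushforward mX1)//; first by apply/measurable_EFinP; case: mf.
  apply: bounded_measurable_integrable; first by rewrite preimage_setT.
  exact: (bounded_measurable_comp mX1).
- by apply: eq_measure_integral => A mA _; exact: law_unique.
- rewrite (integral_pushforward mX2)//; first by apply/measurable_EFinP; case: mf.
  apply: bounded_measurable_integrable; first by rewrite preimage_setT.
  exact: (bounded_measurable_comp mX2).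
Qed.

End Law.
End CoordinateSpace.
Arguments coord_space : clear implicits.

(** * Independent families: transformations and factorization *)

Section IndependentFamily.
Context {I : choiceType} {d} {T : measurableType d} {R : realType}.
Variables (P : probability T R) (X : I -> T -> R).
Hypothesis mX : forall k, measurable_fun setT (X k).
Hypothesis indX : mutually_independent P X.

Definition joint (u : T) : coord_space I R := fun k => X k u.

Lemma measurable_joint : measurable_fun setT joint.
Proof. exact: measurable_fun_coord_space. Qed.

Lemma joint_cylinder s A : uniq s -> (forall k, measurable (A k)) ->
  P (joint @^-1` cylinder s A) = (\prod_(k <- s) P (X k @^-1` A k))%E.
Proof. by move=> us mA; rewrite preimage_cylinder; exact: indX. Qed.

Section Transform.
Variables (s t : I -> I) (phi : I -> R -> R).
Hypothesis st : cancel s t.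
Hypothesis mphi : forall k, measurable_fun setT (phi k).
Hypothesis phiX : forall k A, measurable A ->
  P (X (s k) @^-1` (phi k @^-1` A)) = P (X k @^-1` A).

Let Y (u : T) : coord_space I R := fun k => phi k (X (s k) u).

Let mY : measurable_fun setT Y.
Proof. by apply: measurable_fun_coord_space => k; exact: measurableT_comp. Qed.

Let Y_cylinder r A : uniq r -> (forall k, measurable (A k)) ->
  P (Y @^-1` cylinder r A) = P (joint @^-1` cylinder r A).
Proof.
move=> ur mA; rewrite joint_cylinder// preimage_cylinder.
have mB k : measurable (phi k @^-1` A k) by rewrite -[X in measurable X]setTI; exact: mphi.
have us : uniq (map s r) by rewrite map_inj_uniq//; exact: can_inj st.
have := indX (A := fun j => phi (t j) @^-1` A (t j)) us (fun k => mB (t k)); rewrite !big_map.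
under eq_bigr do rewrite st; under [in X in _ = X]eq_bigr do rewrite st.
by move=> ->; apply: eq_bigr => k _; exact: phiX.
Qed.

(** Independence and the one-dimensional laws determine the law on cylinders, so an injective
    reindexing combined with maps that preserve each marginal leaves the joint law unchanged.
    Shifts, the reflection and the flip of one coin are all of this form. *)
Lemma joint_transform_expect (f : coord_space I R -> R) : bounded_measurable f ->
  \int[P]_u f (fun k => phi k (X (s k) u)) = \int[P]_u f (joint u).
Proof. exact: (law_unique_expect mY measurable_joint Y_cylinder). Qed.

End Transform.

Section Product.
Variables (S : pred I) (f g : coord_space I R -> R).
Hypotheses (mf : bounded_measurable f) (mg : bounded_measurable g).
Hypothesis fS : forall w w', (forall k, S k -> w k = w' k) -> f w = f w'.
Hypothesis gS : forall w w', (forall k, ~~ S k -> w k = w' k) -> g w = g w'.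

Let glue (u : T * T) : coord_space I R := fun k => if S k then X k u.1 else X k u.2.

Let mglue : measurable_fun setT glue.
Proof.
apply: measurable_fun_coord_space => k; rewrite /glue.
by case: (S k); [exact: (measurableT_comp (mX k) measurable_fst)
                |exact: (measurableT_comp (mX k) measurable_snd)].
Qed.

Let PP : probability (T * T)%type R := (P \x P)%E.

Let glue_cylinder r A : uniq r -> (forall k, measurable (A k)) ->
  P (joint @^-1` cylinder r A) = PP (glue @^-1` cylinder r A).
Proof.
move=> ur mA; rewrite joint_cylinder//.
have mXA k : measurable (X k @^-1` A k) by rewrite -[X in measurable X]setTI; exact: mX.
(* Coordinates in [S] read only the first copy and the others only the second, so a cylinder pulls
   back to a rectangle. *)
have -> : glue @^-1` cylinder r A =
  (joint @^-1` cylinder [seq k <- r | S k] A) `*` (joint @^-1` cylinder [seq k <- r | ~~ S k] A).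
  apply/seteqP; split => -[u u'].
    by move=> h; split=> k /=; rewrite mem_filter => /andP[Sk kr]; have := h k kr;
       rewrite /glue ?Sk ?(negbTE Sk).
  move=> [h h'] k kr; rewrite /glue; case: (boolP (S k)) => Sk.
    by have := h k; rewrite mem_filter Sk kr; exact.
  by have := h' k; rewrite mem_filter Sk kr; exact.
have mj q : measurable (joint @^-1` cylinder q A).
  by rewrite preimage_cylinder; apply: bigsetI_measurable => k _; exact: mXA.
rewrite /PP/= product_measure1E// (bigID S)/=; congr (_ * _)%E;
by rewrite -big_filter; apply/esym/joint_cylinder => //; exact: filter_uniq.
Qed.

(* [glue] has the law of [joint] and splits [f] and [g] between two independent copies. *)
Lemma joint_expectM :
  \int[P]_u (f (joint u) * g (joint u)) = \int[P]_u f (joint u) * \int[P]_u g (joint u).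
Proof.
have mfg : bounded_measurable (fun w => f w * g w) by exact: bounded_measurableM.
have mfj : bounded_measurable (f \o joint) := bounded_measurable_comp measurable_joint mf.
have mgj : bounded_measurable (g \o joint) := bounded_measurable_comp measurable_joint mg.
rewrite (law_unique_expect measurable_joint mglue glue_cylinder mfg).
have fgE u : f (glue u) * g (glue u) = f (joint u.1) * g (joint u.2).
  by congr (_ * _); [apply: fS => k Sk; rewrite /glue Sk
                    |apply: gS => k Sk; rewrite /glue (negbTE Sk)].
rewrite /Rintegral; under eq_integral do rewrite fgE.
rewrite -integral12_prod_meas1; last first.
  apply: (bounded_measurable_integrable PP measurableT).
  under eq_fun do rewrite -fgE; exact: (bounded_measurable_comp mglue mfg).
rewrite -/(Rintegral _ _ _) -/(Rintegral _ _ _) -RintegralZr//; last first.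
  exact: bounded_measurable_integrable.
congr fine; apply: eq_integral => u _; rewrite /fubini_F /=.
rewrite -expectZ// /Rintegral fineK//.
by apply: integrable_fin_num => //; apply: bounded_measurable_integrable => //;
   exact: bounded_measurableZ.
Qed.

End Product.
End IndependentFamily.

(** * A subadditive ergodic theorem under finite-range dependence *)

Section LinearGrowth.
Context {R : realType}.
Implicit Types (a : nat -> R) (g : R).

Definition grows_like a g :=
  forall e : R, 0 < e -> exists N, forall n, (N <= n)%N -> `|a n - g * n%:R| <= e * n%:R.

Lemma natr_large (x : R) : exists N : nat, forall n, (N <= n)%N -> x <= n%:R.
Proof.
exists (Num.truncn `|x|).+1 => n Nn; rewrite (le_trans (ler_norm x))//.
by rewrite (le_trans (ltW (truncnS_gt _)))// ler_nat.
Qed.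

Lemma grows_like_cvg a g : grows_like a g <-> ((fun n => a n / n%:R) @ \oo --> g).
Proof.
split=> [ag|/cvgrPdist_le ag e e0].
  apply/cvgrPdist_le => e e0; have [N aN] := ag _ e0; exists (maxn 1 N) => // n /= Nn.
  have n1 : 0 < n%:R :> R by rewrite ltr0n; lia.
  have -> : g - a n / n%:R = (g * n%:R - a n) / n%:R by field; rewrite gt_eqF.
  by rewrite normrM normfV (gtr0_norm n1) ler_pdivrMr// distrC aN//; lia.
have [N _ aN] := ag _ e0; exists (maxn 1 N) => n Nn; have n1 : 0 < n%:R :> R by rewrite ltr0n; lia.
have -> : a n - g * n%:R = (a n / n%:R - g) * n%:R by field; rewrite gt_eqF.
by rewrite normrM (gtr0_norm n1) ler_pM2r// distrC; apply: aN => /=; lia.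
Qed.

Lemma le0_of_bounded_multiples (a b : R) :
  (forall k, (0 < k)%N -> a * k%:R <= b) -> a <= 0.
Proof.
move=> ab; rewrite leNgt; apply/negP => a0.
have [N /(_ N.+1 (leqnSn N))] := natr_large ((b + 1) / a).
rewrite ler_pdivrMr// mulrC => h; have := ab N.+1 isT; lra.
Qed.

Lemma sqrt_bracket (n : nat) : exists j, (j * j <= n < j.+1 * j.+1)%N.
Proof.
elim: n => [|n [j jn]]; first by exists 0%N.
by case: (ltnP n.+1 (j.+1 * j.+1)) => h; [exists j | exists j.+1]; nia.
Qed.

Lemma sum_inv_sq_le (n : nat) :
  \sum_(0 <= j < n.+1) ((j.+1%:R ^+ 2)^-1 : R) <= 2 - n.+1%:R^-1.
Proof.
elim: n => [|n IH]; first by rewrite big_nat1 expr1n invr1; lra.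
rewrite big_nat_recr//=; apply: (le_trans (lerD IH (lexx _))).
have n0 : 0 < n.+1%:R :> R by rewrite ltr0n.
rewrite -[n.+2]addn1 natrD; set x : R := n.+1%:R in n0 *.
rewrite -subr_ge0 (_ : _ - _ = (x * (x + 1) ^+ 2)^-1); first by rewrite invr_ge0; nra.
by field; rewrite !gt_eqF//; lra.
Qed.

End LinearGrowth.

(** * A law of large numbers under finite-range correlation *)

Section WeakLaw.
Context {d} {T : measurableType d} {R : realType}.
Variables (P : probability T R) (Y : nat -> T -> R) (D : R) (K : nat).
Hypothesis mY : forall j, measurable_fun setT (Y j).
Hypothesis YD : forall j u, `|Y j u| <= D.
Hypothesis Y_dep : forall i j, (i + K <= j)%N -> \int[P]_u (Y i u * Y j u) = 0.

Let S k u : R := \sum_(0 <= j < k) Y j u.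
Let V : R := (2 * K%:R + 1) * D ^+ 2.

Let bY j : bounded_measurable (Y j).
Proof. by split => //; exists D. Qed.

Let bS k : bounded_measurable (S k).
Proof. exact: bounded_measurable_sum. Qed.

Let bSS k : bounded_measurable (fun u => S k u ^+ 2).
Proof. by under eq_fun do rewrite expr2; exact: bounded_measurableM. Qed.

(** Each [Y k] is correlated with at most [K] earlier terms: passing from [k] to [k + 1] adds at
    most [2 K D^2] for the cross terms and [D^2] for the square, together [V]. *)
Lemma sum_second_moment k : \int[P]_u (S k u ^+ 2) <= V * k%:R.
Proof.
have YY i j : \int[P]_u (Y i u * Y j u) <= D ^+ 2.
  rewrite -[leRHS](expect_cst P); apply: expect_le.
  - exact: bounded_measurableM.
  - exact: bounded_measurable_cst.
  move=> u; rewrite (le_trans (ler_norm _))// normrM expr2.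
  by apply: ler_pM.
elim: k => [|k IH].
  rewrite mulr0 (_ : (fun _ => _) = fun=> 0) ?expect_cst//.
  by apply/funext => u; rewrite /S big_geq// expr0n.
have -> : \int[P]_u (S k.+1 u ^+ 2) =
    \int[P]_u (S k u ^+ 2) + 2 * \int[P]_u (S k u * Y k u) + \int[P]_u (Y k u * Y k u).
  rewrite -expectZ; last exact: bounded_measurableM.
  rewrite -expectD//; last exact/bounded_measurableZ/bounded_measurableM.
  rewrite -expectD.
  - by congr Rintegral; apply/funext => u; rewrite /S big_nat_recr//=; ring.
  - by apply: bounded_measurableD => //; exact/bounded_measurableZ/bounded_measurableM.
  - exact: bounded_measurableM.
suff : \int[P]_u (S k u * Y k u) <= K%:R * D ^+ 2.
  by have := YY k k; rewrite -[k.+1]addn1 natrD /V in IH *; lra.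
have -> : \int[P]_u (S k u * Y k u) = \sum_(0 <= j < k) \int[P]_u (Y j u * Y k u).
  rewrite -expect_sum; last by move=> j; exact: bounded_measurableM.
  by congr Rintegral; apply/funext => u; rewrite /S mulr_suml.
rewrite (@big_cat_nat _ _ _ (k - K)%N)//= ?leq_subr//.
rewrite [X in X + _]big_nat_cond [X in X + _]big1 ?add0r; last first.
  by move=> j /andP[/andP[_ jk] _]; apply: Y_dep; lia.
apply: (@le_trans _ _ (\sum_(k - K <= j < k) D ^+ 2)); first exact: ler_sum.
rewrite sumr_const_nat -[leLHS]mulr_natl ler_wpM2r ?sqr_ge0// ler_nat; lia.
Qed.

(** From [2 |s| <= s^2 / m + m], in place of the Cauchy-Schwarz inequality. With [m] proportional to
    [k] the bound is a constant plus a small multiple of [k]. *)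
Lemma expect_norm_sum k (m : R) : 0 < m ->
  \int[P]_u `|S k u| <= (V * k%:R / m + m) / 2.
Proof.
move=> m0; apply: (@le_trans _ _ (\int[P]_u ((m^-1 / 2) * S k u ^+ 2 + m / 2))).
  apply: expect_le.
  - exact: bounded_measurable_norm.
  - by apply: bounded_measurableD; [exact: bounded_measurableZ|exact: bounded_measurable_cst].
  move=> u; rewrite -(real_normK (num_real (S k u))); set s := `|S k u|.
  rewrite -subr_ge0 (_ : _ - _ = m^-1 / 2 * (s - m) ^+ 2); last by field; rewrite gt_eqF.
  by rewrite mulr_ge0 ?sqr_ge0// divr_ge0// ltW// invr_gt0.
rewrite expectD; [|exact: bounded_measurableZ|exact: bounded_measurable_cst].
rewrite expect_cst expectZ// mulrDl lerD2r.
rewrite (_ : V * k%:R / m / 2 = m^-1 / 2 * (V * k%:R)); last by ring.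
by rewrite ler_pM2l ?divr_gt0 ?invr_gt0//; exact: sum_second_moment.
Qed.

(* The second moments of [S (j ^ 2) / j ^ 2] are summable in [j]. *)
Lemma square_subsequence_ae : {ae P, forall u, forall e : R, 0 < e ->
  exists J, forall j, (J <= j)%N -> `|S (j * j) u| <= e * (j * j)%:R}.
Proof.
pose f j u : R := (S (j.+1 * j.+1) u / (j.+1 * j.+1)%:R) ^+ 2.
have fE j : f j = fun u => ((j.+1 * j.+1)%:R ^- 2) * S (j.+1 * j.+1) u ^+ 2.
  by apply/funext => u; rewrite /f exprMn exprVn mulrC.
have bf j : bounded_measurable (f j) by rewrite fE; exact: bounded_measurableZ.
have f0 j u : 0 <= f j u by rewrite sqr_ge0.
have mf j : measurable_fun setT (EFin \o f j) by apply/measurable_EFinP; case: (bf j).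
have V0 : 0 <= V by rewrite mulr_ge0 ?sqr_ge0// addr_ge0// mulr_ge0.
have If j : (\int[P]_u (f j u)%:E <= (V * (j.+1%:R ^+ 2)^-1)%:E)%E.
  rewrite -[leLHS]fineK; last first.
    by apply: integrable_fin_num => //; exact: bounded_measurable_integrable.
  rewrite lee_fin -/(Rintegral P setT (f j)) fE expectZ//.
  apply: (le_trans (ler_wpM2l _ (sum_second_moment _))); first by rewrite invr_ge0 exprn_ge0.
  rewrite natrM le_eqVlt; apply/orP; left; apply/eqP.
  have : j.+1%:R != 0 :> R by rewrite pnatr_eq0.
  by move: (j.+1%:R : R) => x x0; field.
have sumf : (\int[P]_u (\sum_(0 <= j <oo) (f j u)%:E) <= (2 * V)%:E)%E.
  rewrite integral_nneseries//; last by move=> j u _; rewrite lee_fin.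
  apply: lime_le.
    by apply: is_cvg_nneseries => j _ _; apply: integral_ge0 => u _; rewrite lee_fin.
  apply: nearW => -[|n]; first by rewrite big_geq// lee_fin mulr_ge0.
  apply: (le_trans (lee_sum _ (fun j _ => If j))).
  rewrite sumEFin lee_fin -mulr_sumr mulrC ler_wpM2r//.
  by apply: (le_trans (sum_inv_sq_le _)); rewrite gerBl invr_ge0.
have mF : measurable_fun setT (fun u => \sum_(0 <= j <oo) (f j u)%:E)%E.
  apply: (@ge0_emeasurable_sum _ _ _ setT (fun j u => (f j u)%:E) xpredT).
    by move=> j u _ _; rewrite lee_fin.
  by move=> j _; exact: mf.
have iF : P.-integrable setT (fun u => \sum_(0 <= j <oo) (f j u)%:E)%E.
  apply/integrableP; split; [exact: mF | apply: le_lt_trans (ltry (2 * V))].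
  apply: le_trans sumf; rewrite le_eqVlt; apply/orP; left; apply/eqP/eq_integral => u _.
  by rewrite gee0_abs//; apply: nneseries_ge0 => j _ _; rewrite lee_fin.
have := integrable_ae measurableT iF; apply: filterS => u /(_ Logic.I) Fu e e0.
have fu0 : f ^~ u @ \oo --> 0.
  apply: cvg_series_cvg_0; apply: nondecreasing_is_cvgn.
    by apply: nondecreasing_series => j _ _; exact: f0.
  exists (fine (\sum_(0 <= j <oo) (f j u)%:E)%E) => _ [n _ <-].
  rewrite -lee_fin fineK// /series/= -sumEFin.
  by apply: nneseries_lim_ge => j _ _; rewrite lee_fin.
move/cvgrPdist_le : fu0 => /(_ (e ^+ 2) (exprn_gt0 2 e0))[J _ fJ].
exists J.+1 => -[//|j] /fJ; rewrite sub0r normrN ger0_norm ?f0// /f.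
rewrite -[leLHS]real_normK ?num_real// ler_sqr ?nnegrE ?normr_ge0 ?(ltW e0)//.
have j0 : 0 < (j.+1 * j.+1)%:R :> R by rewrite ltr0n.
by rewrite normrM normfV (gtr0_norm j0) ler_pdivrMr.
Qed.

End WeakLaw.

Lemma measurable_sublevel {d} {T : measurableType d} {R : realType} (f : T -> R) (c : R) :
  measurable_fun setT f -> measurable [set u | f u <= c].
Proof.
move=> mf; have := mf measurableT _ (measurable_itv `]-oo, c]).
by rewrite setTI; congr measurable; apply/seteqP; split=> u /=; rewrite in_itv.
Qed.

Lemma measurable_superlevel {d} {T : measurableType d} {R : realType} (f : T -> R) (c : R) :
  measurable_fun setT f -> measurable [set u | c < f u].
Proof.
move=> mf; have := mf measurableT _ (measurable_itv `]c, +oo[).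
by rewrite setTI; congr measurable; apply/seteqP; split=> u /=; rewrite in_itv/= andbT.
Qed.

(** * Subadditive processes: almost sure upper and lower limits *)

Section SubadditiveErgodic.
Context {d} {T : measurableType d} {dW} {W : measurableType dW} {R : realType}.
Variables (P : probability T R) (Phi : nat -> T -> W) (x : nat -> W -> R) (C : R).

(** [Phi i u] is the environment seen from block [i], and [X i l u] the cost of the next [l] blocks.
    Stationarity is a statement about the laws of the [Phi i], since no shift acts on [T] itself. *)
Let X i l u : R := x l (Phi i u).

Hypothesis mPhi : forall i, measurable_fun setT (Phi i).
Hypothesis mx : forall l, measurable_fun setT (x l).
Hypothesis xC : forall l w, `|x l w| <= C * l%:R.
Hypothesis X_sub : forall i l l' u, X i (l + l') u <= X i l u + X (i + l) l' u.
Hypothesis stationary : forall i (f : W -> R), bounded_measurable f ->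
  \int[P]_u f (Phi i u) = \int[P]_u f (Phi 0%N u).
Hypothesis X_dep : forall l, exists K, forall i j, (i + K <= j)%N ->
  \int[P]_u (X i l u * X j l u) = \int[P]_u X i l u * \int[P]_u X j l u.

Let e l : R := \int[P]_u X 0%N l u.

Let bx l : bounded_measurable (x l).
Proof. by split => //; exists (C * l%:R) => w; exact: xC. Qed.

Let bX i l : bounded_measurable (X i l).
Proof. exact: (bounded_measurable_comp (mPhi i) (bx l)). Qed.

Let eX i l : \int[P]_u X i l u = e l.
Proof. exact: stationary. Qed.

Let C0 : 0 <= C.
Proof. by have := xC 1 (Phi 0%N point); rewrite mulr1; exact: le_trans. Qed.

Let e_bound l : `|e l| <= C * l%:R.
Proof.
rewrite ler_norml; apply/andP; split.
  rewrite -[leLHS](expect_cst P); apply: expect_le => // [|u].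
    exact: bounded_measurable_cst.
  by have := xC l (Phi 0%N u); rewrite ler_norml => /andP[].
rewrite -[leRHS](expect_cst P); apply: expect_le => // [|u].
  exact: bounded_measurable_cst.
by have := xC l (Phi 0%N u); rewrite ler_norml => /andP[].
Qed.

Let Y l j u : R := X (j * l)%N l u - e l.
Let D l : R := 2 * (C * l%:R).

Let mY l j : measurable_fun setT (Y l j).
Proof.
by have [] : bounded_measurable (Y l j) by apply: bounded_measurableB => //;
   exact: bounded_measurable_cst.
Qed.

Let YD l j u : `|Y l j u| <= D l.
Proof.
rewrite (le_trans (ler_normB _ _))// /D.
by have := xC l (Phi (j * l)%N u); have := e_bound l; rewrite /X; lra.
Qed.

Let Y_dep l : (0 < l)%N -> exists K, forall i j, (i + K <= j)%N ->
  \int[P]_u (Y l i u * Y l j u) = 0.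
Proof.
move=> l0; have [K XK] := X_dep l; exists K => i j ij.
have bM a b : bounded_measurable (fun u => X a l u * X b l u) by exact: bounded_measurableM.
transitivity (\int[P]_u (X (i * l)%N l u * X (j * l)%N l u
                         + (- e l) * X (i * l)%N l u + (- e l) * X (j * l)%N l u + e l * e l)).
  by congr Rintegral; apply/funext => u; rewrite /Y; ring.
have bZ a : bounded_measurable (fun u => (- e l) * X a l u) by exact: bounded_measurableZ.
rewrite expectD; [|by apply: bounded_measurableD => //; apply: bounded_measurableD
                  |exact: bounded_measurable_cst].
rewrite expectD//; last exact: bounded_measurableD.
rewrite expectD// expect_cst !expectZ// XK ?eX; last by nia.
by ring.
Qed.

Let X_blocks l k u : X 0%N (k * l) u <= \sum_(0 <= j < k) Y l j u + e l * k%:R.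
Proof.
elim: k => [|k IH].
  rewrite big_geq// mulr0 addr0 mul0n /X; have := xC 0%N (Phi 0%N u).
  by rewrite mulr0 normr_le0 => /eqP ->.
rewrite big_nat_recr//= mulSn addnC; apply: (le_trans (X_sub _ _ _ _)).
by rewrite add0n -[k.+1]addn1 natrD /Y; lra.
Qed.

Lemma subadditive_upper_ae l : (0 < l)%N -> {ae P, forall u, forall eps : R, 0 < eps ->
  exists N0, forall N, (N0 <= N)%N -> X 0%N N u <= (e l / l%:R + eps) * N%:R}.
Proof.
move=> l0; have [K YK] := Y_dep l0.
have := square_subsequence_ae (mY l) (YD l) YK; apply: filterS => u SJ eps eps0.
have [J SJ'] := SJ (eps / 2) ltac:(by rewrite divr_gt0).
(* An [N] between [j^2 l] and [(j + 1)^2 l] leaves a remainder of at most [3 j l]; it changes the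
   bound by at most [6 C j l], which is below [eps / 2 * j^2 l] once [j >= 12 C / eps]. *)
have [J' J'P] := natr_large (12 * C / eps).
exists ((maxn J (maxn J' 1)) ^ 2 * l)%N => N NN.
have [j /andP[jN Nj]] := sqrt_bracket (N %/ l).
have jJ : (maxn J (maxn J' 1) <= j)%N.
  rewrite leqNgt; apply/negP => jJ.
  have : ((maxn J (maxn J' 1)) ^ 2 <= N %/ l)%N by rewrite leq_divRL.
  by rewrite -mulnn; nia.
have {}SJ' := SJ' j ltac:(lia); have {}J'P := J'P j ltac:(lia).
have jl : (j * j * l <= N)%N by rewrite -leq_divRL.
have Nl : (N <= j * j * l + (2 * j + 1) * l)%N.
  by have : (N < j.+1 * j.+1 * l)%N by [rewrite -ltn_divLR|]; nia.
have XN : X 0%N N u <= X 0%N (j * j * l)%N u + C * (N - j * j * l)%:R.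
  rewrite -{1}(subnKC jl); apply: (le_trans (X_sub _ _ _ _)); rewrite lerD2l.
  by rewrite (le_trans (ler_norm _))// xC.
have := X_blocks l (j * j) u; move: XN SJ'; rewrite ler_norml natrB// => XN /andP[_ SJ'] XB.
have lR : 1 <= l%:R :> R by rewrite ler1n.
have jR : 1 <= j%:R :> R by rewrite ler1n; lia.
move: jl Nl; rewrite -!(ler_nat R) !(natrM, natrD) => jl Nl.
have el : `|e l / l%:R| <= C by rewrite normrM normfV (@ger0_norm _ l%:R)// ler_pdivrMr ?e_bound//; lra.
have eE : e l * j%:R ^+ 2 = (e l / l%:R) * (j%:R * j%:R * l%:R) by field; rewrite gt_eqF//; lra.
move: el; rewrite ler_norml => /andP[el1 el2].
rewrite ler_pdivrMr// in J'P.
move: XB SJ'; rewrite natrM -expr2 eE; move: (e l / l%:R) el1 el2 => g el1 el2 XB SJ'.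
set N' : R := N%:R in XN jl Nl *; set jr : R := j%:R in XN jl Nl jR J'P XB SJ' *.
set lr : R := l%:R in XN jl Nl lR XB SJ' *.
have NC : - (C * (N' - jr * jr * lr)) <= g * (N' - jr * jr * lr) by nra.
have h1 : 2 * (C * (N' - jr * jr * lr)) <= 2 * (C * (3 * jr * lr)).
  by rewrite ler_pM2l// ler_wpM2l//; nra.
have h2 : 6 * C * jr * lr <= eps / 2 * (jr * jr * lr).
  have : 12 * C * (jr * lr) <= jr * eps * (jr * lr) by rewrite ler_wpM2r//; nra.
  by nra.
have h3 : eps / 2 * jr ^+ 2 <= eps / 2 * (jr * jr * lr) by rewrite ler_pM2l ?divr_gt0//; nra.
have h4 : eps * (jr * jr * lr) <= eps * N' by rewrite ler_pM2l.
by nra.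
Qed.

Section Lower.
Variables (g r : R).
Hypothesis ge : forall l, (0 < l)%N -> g * l%:R <= e l.
Hypothesis rg : r < g.
Hypothesis g_inf : forall eps, 0 < eps -> exists2 l, (0 < l)%N & e l <= (g + eps) * l%:R.

(** [U] collects the environments where [x n - r n] is unbounded below. The arbitrary margin [K]
    absorbs the bounded cost of one additional block, which makes the events [E i] decreasing.
    [bad L] gathers the environments in which no block of length 1 to [L] costs at most [r] per
    unit. *)
Let U : set W := \bigcap_K \bigcup_n [set w | x n w <= r * n%:R - K%:R].
Let E i := Phi i @^-1` U.
Let bad (L : nat) : set W := \bigcap_(l in [set l | (1 <= l <= L)%N]) [set w | r * l%:R < x l w].

Let mU : measurable U.
Proof.
apply: bigcapT_measurable => K; apply: bigcupT_measurable => n.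
exact: measurable_sublevel.
Qed.

Let mB L : measurable (bad L).
Proof. by apply: bigcap_measurableType => l _; exact: measurable_superlevel. Qed.

Let mpre i V : measurable V -> measurable (Phi i @^-1` V).
Proof. by move=> mV; rewrite -[X in measurable X]setTI; exact: mPhi. Qed.

Let P_stationary i V : measurable V -> P (Phi i @^-1` V) = P (Phi 0%N @^-1` V).
Proof.
move=> mV; have := stationary i (bounded_measurable_indic mV).
have ind j : (fun u => \1_V (Phi j u)) = (\1_(Phi j @^-1` V) : T -> R).
  by apply/funext => u; rewrite !indicE; congr (_%:R); rewrite !inE.
have mp j := mpre j mV; rewrite !ind (expect_indic _ (mp i)) (expect_indic _ (mp 0%N)) => h.
by rewrite -[LHS]fineK ?fin_num_measure// h fineK ?fin_num_measure.
Qed.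

Let E_step i : E i.+1 `<=` E i.
Proof.
move=> u Eu K _; have [K' K'P] := natr_large (K%:R + C + `|r|).
have [n _ xn] := Eu K' Logic.I; exists n.+1 => //.
have := X_sub i 1 n u; rewrite add1n addn1 /X => h.
have := K'P K' (leqnn _); have := xC 1 (Phi i u); rewrite mulr1.
have := ler_norm (x 1 (Phi i u)); have := ler_norm (- r); rewrite normrN.
move: xn h; rewrite /= -[n.+1%:R]natr1; lra.
Qed.

Let E_sub i : E i `<=` E 0%N.
Proof. by elim: i => // i IH u /E_step /IH. Qed.

(** Nested events of equal probability differ by a null set; this takes the place of invariance of
    [E 0] under a shift. *)
Let PE_diff i : P (E 0%N `\` E i) = 0%E.
Proof.
have mE j : measurable (E j) by exact: mpre.
have PE : P (E i) = P (E 0%N) by exact: P_stationary.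
transitivity (P (E 0%N) - P (E i))%E.
  rewrite measureD//; last by rewrite (le_lt_trans (probability_le1 P _))// ltry.
  by rewrite (setIidr (@E_sub i)).
by rewrite PE subee// fin_num_measure.
Qed.

Let bad_delta (L : nat) : R := fine (P (E 0%N `&` Phi 0%N @^-1` bad L)).

Let bad_cvg : bad_delta @ \oo --> 0.
Proof.
have mEb L : measurable (E 0%N `&` Phi 0%N @^-1` bad L) by apply: measurableI; exact: mpre.
have : (fun L => P (E 0%N `&` Phi 0%N @^-1` bad L)) @ \oo -->
       P (\bigcap_L (E 0%N `&` Phi 0%N @^-1` bad L)).
  apply: nonincreasing_cvg_mu => //.
  - by rewrite (le_lt_trans (probability_le1 P _))// ltry.
  - exact: bigcapT_measurable.
  - move=> m n mn; apply/subsetPset => u [Eu bu]; split => // l /= /andP[l1 lm].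
    by apply: bu => /=; rewrite l1 (leq_trans lm).
have -> : \bigcap_L (E 0%N `&` Phi 0%N @^-1` bad L) = set0.
  rewrite -subset0 => u h; have [Eu _] := h 0%N Logic.I.
  (* The margin 1 excludes [n = 0], since [x 0] vanishes; then [n] is itself a cheap block length,
     so the environment is not in [bad n]. *)
  have [n _ /= xn] := Eu 1%N Logic.I.
  have [n0|n0] := posnP n.
    move: xn; rewrite n0; have := xC 0%N (Phi 0%N u); rewrite !mulr0 normr_le0 => /eqP ->; lra.
  have [_ /(_ n)] := h n Logic.I; rewrite /= n0 leqnn => /(_ isT); lra.
rewrite measure0 => h; have := fine_cvg h; rewrite /bad_delta; exact.
Qed.

(** Greedy tiling of the interval from [i] to [N]: from a good start a block of length at most [L]
    is taken at rate [r], from a bad one a single step whose excess over [r] is at most [C + |r|],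
    and a last stretch of length at most [L] is paid in full. *)
Let tiling L N u i : (0 < L)%N -> (i <= N)%N -> X i (N - i) u <= r * (N - i)%:R +
  (C + `|r|) * (\sum_(i <= j < N) \1_(Phi j @^-1` bad L) u) + (C + `|r|) * L%:R.
Proof.
move=> L0; have [m] := ubnP (N - i); elim: m i => // m IH i.
rewrite ltnS => Nim iN.
have rr := ler_norm r; have rr' : - r <= `|r| by rewrite -normrN ler_norm.
have r0 := normr_ge0 r.
have sum0 a : 0 <= \sum_(a <= j < N) \1_(Phi j @^-1` bad L) u :> R by exact: sumr_ge0.
have xi l : x l (Phi i u) <= C * l%:R by exact: le_trans (ler_norm _) (xC _ _).
have [NL|NL] := leqP (N - i) L.
  have := xi (N - i)%N; rewrite /X; have := sum0 i.
  move: (\sum_(i <= j < N) _) => s s0 xs.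
  have : (N - i)%:R <= L%:R :> R by rewrite ler_nat.
  have : 0 <= (N - i)%:R :> R by []; move: (N - i)%:R L%:R xs => a b xs a0 ab.
  have : (C + `|r|) * a <= (C + `|r|) * b by rewrite ler_wpM2l// addr_ge0.
  have : 0 <= (C + `|r|) * s by rewrite mulr_ge0// addr_ge0.
  have : - r * a <= `|r| * a by rewrite ler_wpM2r.
  by lra.
have [/set_mem badi|] := boolP (u \in Phi i @^-1` bad L).
  have iN' : (i < N)%N by lia.
  have h := X_sub i 1 (N - i.+1) u; have := IH i.+1 ltac:(lia) ltac:(lia).
  rewrite [X in _ -> _ <= _ + _ * X + _]big_ltn//.
  have -> : \1_(Phi i @^-1` bad L) u = 1 :> R by rewrite indicE mem_set.
  rewrite (_ : (1 + (N - i.+1))%N = (N - i)%N) in h; last by lia.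
  rewrite (_ : (N - i)%:R = 1 + (N - i.+1)%:R :> R); last by rewrite addrC natr1; congr (_%:R); lia.
  have := xi 1%N; move: h; rewrite /X addn1 mulr1; lra.
rewrite notin_setE => /existsNP[l /not_implyP[/= /andP[l1 lL]]] /negP; rewrite -leNgt => good.
have h := X_sub i l (N - (i + l)) u; have := IH (i + l)%N ltac:(lia) ltac:(lia).
rewrite (_ : (l + (N - (i + l)))%N = (N - i)%N) in h; last by lia.
rewrite [X in _ -> _ <= _ + _ * X + _](@big_cat_nat _ _ _ (i + l)%N)/=; [|lia|lia].
have : 0 <= \sum_(i <= j < i + l) \1_(Phi j @^-1` bad L) u :> R by exact: sumr_ge0.
rewrite (_ : (N - i)%:R = l%:R + (N - (i + l))%:R :> R); last by rewrite -natrD; congr (_%:R); lia.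
have : 0 <= (C + `|r|) * (\sum_(i <= j < i + l) \1_(Phi j @^-1` bad L) u).
  by rewrite mulr_ge0// ?addr_ge0// sumr_ge0.
move: h good; rewrite /X; lra.
Qed.

(** [E 0] is [E j] up to a null set, and [E j] intersected with [bad L] seen from [j] has the same
    probability as at 0 by stationarity. *)
Let delta_ge j L : fine (P (E 0%N `&` Phi j @^-1` bad L)) <= bad_delta L.
Proof.
have mE i : measurable (E i) by exact: mpre.
have mb i : measurable (Phi i @^-1` bad L) by exact: mpre.
apply: fine_le; rewrite ?fin_num_measure//; try exact: measurableI.
have -> : P (E 0%N `&` Phi 0%N @^-1` bad L) = P (E j `&` Phi j @^-1` bad L).
  by rewrite -!preimage_setI -(P_stationary j)//; exact: measurableI.
apply: (@le_trans _ _ (P ((E j `&` Phi j @^-1` bad L) `|` (E 0%N `\` E j)))).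
  apply: le_measure; rewrite ?inE; [exact: measurableI| |].
    by apply: measurableU; [exact: measurableI|exact: measurableD].
  by move=> u [Eu bu]; case: (pselect (E j u)) => Eju; [left|right].
rewrite (le_trans (measureU2 _ _ _))//; [exact: measurableI|exact: measurableD|].
by rewrite -[leRHS]adde0 leeD2l// -[leRHS](PE_diff j).
Qed.

(* On [E 0] almost every starting point [i] lies in [E i], hence is good for [L] large outside
   small probability; [tiling] then bounds the mean on [E 0] by [r], while on the complement the
   block means bound it by [g]. *)
Lemma excess_null : P (E 0%N) = 0%E.
Proof.
have mE i : measurable (E i) by exact: mpre.
pose p := fine (P (E 0%N)).
have p0 : 0 <= p by exact: fine_ge0.
have p1 : p <= 1 by rewrite -lee_fin fineK ?fin_num_measure// probability_le1.
have C'0 : 0 <= C + `|r| by rewrite addr_ge0.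
have dL0 L : 0 <= bad_delta L by exact: fine_ge0.
have key l L (eps : R) : (0 < l)%N -> (0 < L)%N -> 0 < eps -> exists B,
    forall k, (0 < k)%N ->
    (g * l%:R - r * l%:R * p - e l * (1 - p) - (C + `|r|) * l%:R * bad_delta L - eps / 2)
      * k%:R <= B.
  move=> l0 L0 eps0; have [K YK] := Y_dep l0.
  exists ((C + `|r|) * L%:R + (2 * K%:R + 1) * D l ^+ 2 / eps / 2) => k k0.
  have kR : 0 < k%:R :> R by rewrite ltr0n.
  (* With [m = eps k] the mean of [|S|] is at most a constant plus [eps k / 2]; the constant goes
     into [B]. *)
  have SN := expect_norm_sum (mY l) (YD l) YK k (mulr_gt0 eps0 kR).
  pose S u := \sum_(0 <= j < k) Y l j u.
  pose Bd u := \sum_(0 <= j < k * l) (\1_(E 0%N `&` Phi j @^-1` bad L) u : R).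
  have bS : bounded_measurable S.
    by apply: bounded_measurable_sum => j; split; [exact: mY|exists (D l)].
  have bB : bounded_measurable Bd.
    apply: bounded_measurable_sum => j; apply: bounded_measurable_indic.
    by apply: measurableI => //; exact: mpre.
  have b1 : bounded_measurable (\1_(E 0%N) : T -> R) by exact: bounded_measurable_indic.
  have bSn := bounded_measurable_norm bS.
  have bc (c : R) : bounded_measurable (fun _ : T => c) by exact: bounded_measurable_cst.
  (* Added to [e l * k], the term [a * \1_(E 0)] gives the tiling bound [r * (k l)] on [E 0] and
     keeps the block bound off it. *)
  pose a := r * (k * l)%:R - e l * k%:R.
  have : e (k * l)%N <= \int[P]_u (a * \1_(E 0%N) u + (C + `|r|) * Bd u + `|S u| +
                                  ((C + `|r|) * L%:R + e l * k%:R)).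
    apply: expect_le => // [|u].
      do 3! apply: bounded_measurableD => //; exact: bounded_measurableZ.
    have := X_blocks l k u; rewrite -/(S u) => XB; have := ler_norm (S u).
    have := normr_ge0 (S u).
    have : 0 <= (C + `|r|) * L%:R by rewrite mulr_ge0.
    rewrite indicE; case: (boolP (u \in E 0%N)) => Eu CL.
      have := tiling u L0 (leq0n (k * l)); rewrite subn0 /a => XT.
      have -> : Bd u = \sum_(0 <= j < k * l) \1_(Phi j @^-1` bad L) u.
        apply: eq_bigr => j _; rewrite !indicE; congr (_%:R).
        by rewrite in_setI Eu.
      by rewrite mulr1; lra.
    have : 0 <= (C + `|r|) * Bd u by rewrite mulr_ge0// sumr_ge0.
    by rewrite mulr0; lra.
  rewrite expectD//; last by do 2! apply: bounded_measurableD => //; exact: bounded_measurableZ.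
  rewrite expectD//; last by apply: bounded_measurableD => //; exact: bounded_measurableZ.
  rewrite expectD//; try exact: bounded_measurableZ.
  rewrite expect_cst (expectZ _ _ b1) (expectZ _ _ bB) expect_indic// -/p.
  have : \int[P]_u Bd u <= (k * l)%:R * bad_delta L.
    rewrite expect_sum; last first.
      by move=> j; apply: bounded_measurable_indic; apply: measurableI => //; exact: mpre.
    have -> : (k * l)%:R * bad_delta L = \sum_(0 <= j < k * l) bad_delta L.
      by rewrite sumr_const_nat subn0 mulr_natl.
    apply: ler_sum => j _.
    by rewrite expect_indic//; apply: measurableI => //; exact: mpre.
  move=> /(ler_wpM2l C'0) BB.
  have := ge (l := (k * l)%N) ltac:(by rewrite muln_gt0 k0).
  move: SN; rewrite -/(S _) /a natrM.
  have -> : ((2 * K%:R + 1) * D l ^+ 2 * k%:R / (eps * k%:R) + eps * k%:R) / 2 =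
     (2 * K%:R + 1) * D l ^+ 2 / eps / 2 + eps * k%:R / 2.
    by field; rewrite !gt_eqF.
  move: BB; rewrite natrM; lra.
have step l L : (0 < l)%N -> (0 < L)%N ->
    g * l%:R - r * l%:R * p - e l * (1 - p) - (C + `|r|) * l%:R * bad_delta L <= 0.
  move=> l0 L0; apply/ler_addgt0Pr => eps eps0.
  have [B hB] := key l L (2 * eps) l0 L0 ltac:(by rewrite mulr_gt0).
  by have := le0_of_bounded_multiples hB; lra.
(* With [e l] within [eta l] of [g l] and [bad_delta L] at most [eta], the terms in [g] cancel
   except for [(g - r) p]. *)
have pe eta : 0 < eta -> (g - r) * p <= eta * (1 + (C + `|r|)).
  move=> eta0; have [l l0 el] := g_inf eta0.
  have [L [L0 dL]] : exists L, (0 < L)%N /\ bad_delta L <= eta.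
    move/cvgrPdist_le : bad_cvg => /(_ _ eta0)[L _ /(_ L.+1 (leqnSn L))].
    by rewrite sub0r normrN => dL; exists L.+1; split => //; exact: le_trans (ler_norm _) dL.
  have := step l L l0 L0; have lR : 0 < l%:R :> R by rewrite ltr0n.
  have : e l * (1 - p) <= (g + eta) * l%:R * (1 - p) by rewrite ler_wpM2r// subr_ge0.
  have : (C + `|r|) * l%:R * bad_delta L <= (C + `|r|) * l%:R * eta.
    by rewrite ler_wpM2l// mulr_ge0// ltW.
  move=> h1 h2 h3; rewrite -(ler_pM2r lR).
  have : 0 <= eta * l%:R * p by rewrite !mulr_ge0// ltW.
  by lra.
have : (g - r) * p <= 0.
  apply/ler_addgt0Pr => eps eps0; rewrite add0r.
  have c1 : 0 < 1 + (C + `|r|) by lra.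
  by have := pe (eps / (1 + (C + `|r|))) (divr_gt0 eps0 c1); rewrite divfK// gt_eqF.
rewrite pmulr_rle0 ?subr_gt0// => p00.
have pE : p = 0 by apply/eqP; rewrite eq_le p00.
by rewrite -[LHS]fineK ?fin_num_measure// -/p pE.
Qed.

End Lower.

Lemma subadditive_mean_rate g : (forall l, (0 < l)%N -> g * l%:R <= e l) ->
  (forall eps, 0 < eps -> exists2 l, (0 < l)%N & e l <= (g + eps) * l%:R) ->
  grows_like e g.
Proof.
move=> ge g_inf eps eps0; have [l l0 el] := g_inf (eps / 2) ltac:(by rewrite divr_gt0).
have [N0 N0P] := natr_large (2 * (`|g| + C) * l%:R / eps).
exists (maxn 1 N0) => N NN.
rewrite ger0_norm; last by rewrite subr_ge0 ge//; lia.
have h1 : e N <= e (N %/ l * l)%N + C * (N %% l)%:R.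
  rewrite {1}(divn_eq N l).
  apply: (@le_trans _ _ (\int[P]_u (X 0%N (N %/ l * l) u + X (N %/ l * l) (N %% l) u))).
    by apply: expect_le; [exact: bX|exact: bounded_measurableD|move=> u; exact: X_sub].
  rewrite expectD// lerD2l eX; exact: le_trans (ler_norm _) (e_bound _).
have h2 : e (N %/ l * l)%N <= e l * (N %/ l)%:R.
  have bY j : bounded_measurable (Y l j).
    by apply: bounded_measurableB => //; exact: bounded_measurable_cst.
  have bYs := bounded_measurable_sum (index_iota 0 (N %/ l)) bY.
  apply: (@le_trans _ _ (\int[P]_u (\sum_(0 <= j < N %/ l) Y l j u + e l * (N %/ l)%:R))).
    apply: expect_le; [exact: bX| |move=> u; exact: X_blocks].
    by apply: bounded_measurableD => //; exact: bounded_measurable_cst.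
  rewrite expectD//; last exact: bounded_measurable_cst.
  rewrite expect_cst expect_sum// big1 ?add0r// => j _.
  by rewrite expectB ?expect_cst ?eX ?subrr//; exact: bounded_measurable_cst.
have := N0P N ltac:(lia); rewrite ler_pdivrMr// => hN.
have h3 : e l * (N %/ l)%:R <= (g + eps / 2) * l%:R * (N %/ l)%:R by rewrite ler_wpM2r.
have NE : N%:R = (N %/ l)%:R * l%:R + (N %% l)%:R :> R by rewrite -natrM -natrD -divn_eq.
have h4 : (C + `|g|) * (N %% l)%:R <= (C + `|g|) * l%:R.
  by rewrite ler_wpM2l ?addr_ge0// ler_nat ltnW// ltn_mod.
have h5 : - g * (N %% l)%:R <= `|g| * (N %% l)%:R by rewrite ler_wpM2r// -normrN ler_norm.
have h6 : 0 <= eps / 2 * (N %% l)%:R by rewrite mulr_ge0// divr_ge0// ltW.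
by move: h1 h2 h3 hN; rewrite NE; lra.
Qed.

Lemma subadditive_ergodic : exists g, [/\ (forall l, (0 < l)%N -> g * l%:R <= e l),
  grows_like e g & {ae P, forall u, grows_like (fun n => X 0%N n u) g}].
Proof.
pose A := [set e l / l%:R | l in [set l | (0 < l)%N]].
have lbA : lbound A (- C).
  move=> _ [l /= l0 <-]; rewrite ler_pdivlMr ?ltr0n// mulNr.
  by have := e_bound l; rewrite ler_norml => /andP[].
have A1 : A (e 1%N / 1) by exists 1%N.
have ge l : (0 < l)%N -> inf A * l%:R <= e l.
  move=> l0; rewrite -ler_pdivlMr ?ltr0n//; apply: ge_inf; first by exists (- C).
  by exists l.
have g_inf eps : 0 < eps -> exists2 l, (0 < l)%N & e l <= (inf A + eps) * l%:R.
  move=> eps0; have [] := @inf_adherent _ A eps eps0.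
    by split; [exists (e 1%N / 1) | exists (- C)].
  by move=> _ [l /= l0 <-] /ltW; rewrite ler_pdivrMr ?ltr0n// => h; exists l.
exists (inf A); split => //; first exact: subadditive_mean_rate.
set g := inf A in ge g_inf *; clearbody g.
have rg p : g - p.+1%:R^-1 < g by rewrite gtrBl invr_gt0 ltr0n.
(* A lower limit below [g] would lie below some level [g - 1 / (p + 1)]. Countably many levels
   suffice, and avoiding the event at one level provides a [K] with [x n > (g - 1 / (p + 1)) n - K]
   for all [n]. *)
have /ae_foralln low p : {ae P, forall u, ~ (Phi 0%N @^-1` (\bigcap_K \bigcup_n
    [set w | x n w <= (g - p.+1%:R^-1) * n%:R - K%:R])) u}.
  have := excess_null ge (rg p) g_inf; move=> E0.
  exists (Phi 0%N @^-1` (\bigcap_K \bigcup_n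
    [set w | x n w <= (g - p.+1%:R^-1) * n%:R - K%:R])); split => //.
    rewrite -[X in measurable X]setTI; apply: mPhi => //.
    by apply: bigcapT_measurable => K; apply: bigcupT_measurable => n;
       exact: measurable_sublevel.
  by move=> u /= /contrapT.
have /ae_foralln up l := subadditive_upper_ae (ltn0Sn l).
apply: filterS2 low up => u low up eps eps0.
have e2 : 0 < eps / 2 by rewrite divr_gt0.
have [l l0 el] := g_inf _ e2.
case: l l0 el => // l _ el; have [N1 N1P] := up l _ e2.
have [q qP] := natr_large (2 / eps).
have [K KP] : exists K : nat, forall n, (g - q.+1%:R^-1) * n%:R - K%:R < x n (Phi 0%N u).
  have /existsNP[K /not_implyP[_ hK]] := low q; exists K => n.
  by rewrite ltNge; apply/negP => h; apply: hK; exists n.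
have [N2 N2P] := natr_large (2 * K%:R / eps).
exists (maxn N1 N2) => n nN; rewrite ler_norml; apply/andP; split.
  have := N2P n ltac:(lia); rewrite ler_pdivrMr// => hn; have := KP n.
  have qe : q.+1%:R^-1 <= eps / 2.
    rewrite -[leRHS]invf_div lef_pV2 ?posrE ?divr_gt0 ?ltr0n//.
    by apply: qP; exact: leqnSn.
  have : q.+1%:R^-1 * n%:R <= eps / 2 * n%:R by rewrite ler_wpM2r.
  move: hn; rewrite /X; move: (x n _) (q.+1%:R^-1 : R) (n%:R : R) (K%:R : R) => a b c f.
  by lra.
have := N1P n ltac:(lia).
have : (e l.+1 / l.+1%:R) * n%:R <= (g + eps / 2) * n%:R.
  by rewrite ler_wpM2r// ler_pdivrMr ?ltr0n.
by move: (e l.+1 / _) (X 0%N n u) => a b; lra.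
Qed.

End SubadditiveErgodic.

(** * From rational directions to all slopes *)

Section Comparison.
Context {R : realType}.
Implicit Types (A : nat -> int -> R) (y : nat -> int).

(** Shared by the cost in a fixed environment and by the mean cost, so that one comparison of slopes
    serves both. *)
Definition extendable (c : R) A :=
  (forall n (x : int), `|x| <= n%:Z -> `|A n x| <= c * n%:R) /\
  (forall s t (x z : int), `|x| <= s%:Z -> `|z| <= t%:Z ->
    A (s + t)%N (x + z) <= A s x + c * t%:R).

Lemma extendable_le c A n n' (x x' : int) : extendable c A -> (n <= n')%N -> `|x| <= n%:Z ->
  `|x' - x| <= (n' - n)%:Z -> A n' x' <= A n x + c * (n' - n)%:R.
Proof.
move=> [_ Ae] nn' xn xx'; have := Ae n (n' - n)%N x (x' - x) xn xx'.
by rewrite subnKC// addrC subrK.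
Qed.

Lemma norm_intr_le (x : int) (n : nat) : (`|x%:~R : R| <= n%:R) = (`|x| <= n%:Z).
Proof. by rewrite -intr_norm -[n%:R]/(n%:Z%:~R) ler_int. Qed.

Section Direction.
Variables (c : R) (n0 : nat) (m0 : int) (a eta : R).
Let b : R := m0%:~R / n0%:R.
Hypotheses (c0 : 0 <= c) (n00 : (0 < n0)%N) (m0n0 : `|m0| < n0%:Z).
Hypotheses (eta0 : 0 < eta) (eta1 : eta <= 1 / 2) (ab : `|a - b| < (1 - `|b|) * eta).

Let n0p : 0 < n0%:R :> R. Proof. by rewrite ltr0n. Qed.

Let bn0 : b * n0%:R = m0%:~R. Proof. by rewrite divfK// pnatr_eq0 -lt0n. Qed.

Let b1 : `|b| < 1.
Proof.
rewrite normrM normfV (@ger0_norm _ n0%:R)// ltr_pdivrMr ?n0p// mul1r -intr_norm.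
by rewrite -[n0%:R]/(n0%:Z%:~R) ltr_int.
Qed.

(** With [r] the time between [N] and [k n0], the spatial gap consists of [x - a N], of [(a - b) N],
    and of at most [|b| r]. As [r >= eta N], the first two fit into [(1 - |b|) r]; this is the
    origin of the condition on [|a - b|]. *)
Let close_endpoint (N k : nat) (x : int) (r : R) :
  `|x%:~R - a * N%:R| <= ((1 - `|b|) * eta - `|a - b|) * N%:R ->
  eta * N%:R <= r -> `|N%:R - k%:R * n0%:R| = r ->
  `|x%:~R - k%:R * m0%:~R| <= r.
Proof.
have := b1; have := bn0; move: b => b' bn b'1 xa rN rE.
have -> : x%:~R - k%:R * m0%:~R =
  (x%:~R - a * N%:R) + (a - b') * N%:R + b' * (N%:R - k%:R * n0%:R).
  by rewrite -bn; ring.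
have N0 : 0 <= N%:R :> R by [].
apply: (le_trans (ler_normD _ _)); apply: (le_trans (lerD (ler_normD _ _) (lexx _))).
rewrite !normrM rE (ger0_norm N0).
have : (1 - `|b'|) * (eta * N%:R) <= (1 - `|b'|) * r by rewrite ler_wpM2l// subr_ge0 ltW.
by lra.
Qed.

(* The endpoint [(N, y N)] is compared with the multiples [(k n0, k m0)] whose time is about
   [N (1 - eta)] and [N (1 + eta)]: the remaining time is long enough to reach one from the
   other by a lazy walk. *)
Lemma direction_comparison A h y : extendable c A ->
  grows_like (fun k => A (k * n0)%N (k%:Z * m0)) h ->
  (forall N, `|y N| <= N%:Z) -> grows_like (fun N => (y N)%:~R) a ->
  exists N1, forall N, (N1 <= N)%N ->
    `|A N (y N) - h / n0%:R * N%:R| <= (4 * c + 2) * eta * N%:R.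
Proof.
move=> Aext Ah yN ya.
have km (k : nat) : `|k%:Z * m0| <= (k * n0)%:Z.
  by rewrite normrM ger0_norm// PoszM ler_wpM2l// ltW.
have n0p' := n0p; have n0R : 1 <= n0%:R :> R by rewrite ler1n.
have hc : `|h / n0%:R| <= c.
  rewrite normrM normfV (@ger0_norm _ n0%:R)// ler_pdivrMr ?n0p//.
  apply/ler_addgt0Pr => e e0; have [K /(_ K.+1 (leqnSn K)) AK] := Ah _ e0.
  have hA := Aext.1 _ _ (km K.+1); rewrite natrM in hA.
  have k0 : 0 < K.+1%:R :> R by rewrite ltr0n.
  rewrite -(ler_pM2r k0).
  have -> : `|h| * K.+1%:R = `|h * K.+1%:R| by rewrite normrM (gtr0_norm k0).
  rewrite -[h * _](subrK (A (K.+1 * n0)%N (K.+1%:Z * m0))).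
  apply: (le_trans (ler_normD _ _)); rewrite distrC.
  by move: AK hA k0; move: (K.+1%:R : R) (n0%:R : R) => K1 n1 AK hA k0; lra.
have [K AK] := Ah _ eta0.
have e1 : 0 < (1 - `|b|) * eta - `|a - b| by rewrite subr_gt0.
(* [Ny] makes [y N] close to [a N], [N2] makes the chosen multiple [k] at least [K], and [N3] makes
   the rounding error [n0] at most [eta N], hence the time gap at most [2 eta N]. *)
have [Ny yNy] := ya _ e1.
have [N2 N2P] := natr_large ((K%:R + 1) * n0%:R * 2 : R).
have [N3 N3P] := natr_large (n0%:R / eta).
exists (maxn Ny (maxn N2 N3)) => N; rewrite !geq_max => /and3P[/yNy {}yNy /N2P {}N2P /N3P].
rewrite ler_pdivrMr// => {}N3P.
have N0 : 0 <= N%:R :> R by [].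
have hE k : h * k%:R = h / n0%:R * (k%:R * n0%:R) by field; rewrite gt_eqF.
have int_close (k r : nat) : `|(y N)%:~R - k%:R * m0%:~R : R| <= r%:R ->
    `|y N - k%:Z * m0| <= r%:Z.
  by rewrite -norm_intr_le intrB intrM.
have eN0 : 0 <= eta * N%:R by rewrite mulr_ge0// ltW.
have eN1 : eta * N%:R <= 1 / 2 * N%:R by rewrite ler_wpM2r.
have k_le (k : nat) : k%:R <= k%:R * n0%:R :> R by rewrite ler_peMr.
(* The constant [4 c + 2]: an error [eta k <= 2 eta N] in the rate, [2 c eta N] for moving the rate
   from time [k n0] to [N], and [2 c eta N] for the connecting walk. *)
have close_rate (k : nat) (r : R) : (K <= k)%N -> `|N%:R - k%:R * n0%:R| = r ->
    r <= 2 * (eta * N%:R) ->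
    `|A (k * n0)%N (k%:Z * m0) - h / n0%:R * N%:R| + c * r <=
      4 * c * (eta * N%:R) + 2 * (eta * N%:R).
  move=> Kk rE r2.
  have hA := AK _ Kk; rewrite hE in hA.
  have eta_k : eta * k%:R <= 2 * (eta * N%:R).
    rewrite mulrCA ler_pM2l//; apply: (le_trans (k_le k)).
    by move: rE r2 eN1 => <-; have := ler_norm (k%:R * n0%:R - N%:R : R); rewrite distrC; lra.
  have -> : A (k * n0)%N (k%:Z * m0) - h / n0%:R * N%:R =
      (A (k * n0)%N (k%:Z * m0) - h / n0%:R * (k%:R * n0%:R))
      - h / n0%:R * (N%:R - k%:R * n0%:R) by ring.
  apply: (le_trans (lerD (ler_normB _ _) (lexx _))); rewrite (normrM (h / _)) rE.
  have r0 : 0 <= r by rewrite -rE.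
  have h1 : `|h / n0%:R| * r <= c * r by rewrite ler_wpM2r.
  have h2 : c * r <= c * (2 * (eta * N%:R)) by rewrite ler_wpM2l.
  by lra.
rewrite ler_norml; apply/andP; split.
  (* The multiple after [N] gives the lower bound, since its cost exceeds that of [(N, y N)] by at
     most [c] times the gap; the multiple before [N], used further down, gives the upper bound. *)
  pose k := (Num.truncn (N%:R * (1 + eta) / n0%:R)).+1.
  have x0 : 0 <= N%:R * (1 + eta) / n0%:R by rewrite divr_ge0// mulr_ge0// addr_ge0// ltW.
  have /andP[k1 k2] := truncn_itv x0.
  move: k1 k2; rewrite ler_pdivlMr// ltr_pdivrMr// -/k => k1 k2.
  have k3 : k%:R * n0%:R <= N%:R + eta * N%:R + n0%:R by rewrite /k -natr1; lra.
  have kN : (N <= k * n0)%N by rewrite -(ler_nat R) natrM; lra.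
  have rE : (k * n0 - N)%:R = k%:R * n0%:R - N%:R :> R by rewrite natrB// natrM.
  have r1 : eta * N%:R <= (k * n0 - N)%:R by rewrite rE; lra.
  have r2 : (k * n0 - N)%:R <= 2 * (eta * N%:R) by rewrite rE; lra.
  have rN : `|N%:R - k%:R * n0%:R| = (k * n0 - N)%:R :> R.
    by rewrite distrC rE ger0_norm// -rE.
  have yk := close_endpoint yNy r1 rN.
  have kyN : `|k%:Z * m0 - y N| <= (k * n0 - N)%:Z by rewrite distrC; exact: int_close yk.
  have h1 := extendable_le Aext kN (yN N) kyN.
  have Kk : (K <= k)%N.
    have : K%:R * n0%:R <= k%:R * n0%:R :> R by lra.
    by rewrite ler_pM2r// ler_nat.
  have := close_rate _ _ Kk rN r2.
  have := lerNnormlW (lexx `|A (k * n0)%N (k%:Z * m0) - h / n0%:R * N%:R|).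
  by lra.
pose k := Num.truncn (N%:R * (1 - eta) / n0%:R).
have x0 : 0 <= N%:R * (1 - eta) / n0%:R by rewrite divr_ge0// mulr_ge0// subr_ge0 (le_trans eta1)// ler_pdivrMr// mul1r ler1n.
have /andP[k1 k2] := truncn_itv x0.
move: k1 k2; rewrite ler_pdivlMr// ltr_pdivrMr// -/k -natr1 => k1 k2.
have kN : (k * n0 <= N)%N by rewrite -(ler_nat R) natrM; lra.
have rE : (N - k * n0)%:R = N%:R - k%:R * n0%:R :> R by rewrite natrB// natrM.
have r1 : eta * N%:R <= (N - k * n0)%:R by rewrite rE; lra.
have r2 : (N - k * n0)%:R <= 2 * (eta * N%:R) by rewrite rE; lra.
have rN : `|N%:R - k%:R * n0%:R| = (N - k * n0)%:R :> R by rewrite rE ger0_norm// -rE.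
have yk := close_endpoint yNy r1 rN.
have h1 := extendable_le Aext kN (km k) (int_close _ _ yk).
have Kk : (K <= k)%N.
  have : K%:R * n0%:R < (k%:R + 1) * n0%:R :> R by lra.
  by rewrite ltr_pM2r// natr1 ltr_nat ltnS.
have := close_rate _ _ Kk rN r2; have := ler_norm (A (k * n0)%N (k%:Z * m0) - h / n0%:R * N%:R).
by lra.
Qed.

End Direction.
End Comparison.

Section DirectionalRate.
Context {R : realType}.
Implicit Types (A : nat -> int -> R) (y : nat -> int) (h : nat -> int -> R) (a eta : R).

Lemma intpartN (x : R) : intpart (- x) = - intpart x.
Proof.
rewrite /intpart oppr_ge0 opprK; case: (ltgtP x 0) => [_|_|->]; rewrite ?opprK//.
by rewrite oppr0 floor0.
Qed.

Lemma intpart_bounds (x : R) :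
  `|(intpart x)%:~R - x| <= 1 /\ `|(intpart x)%:~R| <= `|x|.
Proof.
wlog x0 : x / 0 <= x => [th|].
  have [/th//|/ltW] := leP 0 x; rewrite -oppr_ge0 => /th.
  by rewrite intpartN mulrNz opprK addrC distrC !normrN addrC.
rewrite /intpart x0.
have f0 : 0 <= (Num.floor x)%:~R :> R by rewrite ler0z floor_ge0.
have := floor_le x; have := floorD1_gt x; rewrite intrD => h1 h2.
split; last by rewrite (ger0_norm x0) ger0_norm.
by rewrite distrC ger0_norm ?subr_ge0//; lra.
Qed.

Lemma intpart_int (m : int) : intpart (m%:~R : R) = m.
Proof. by rewrite /intpart -mulrNz !intrKfloor opprK; case: ifP. Qed.

Lemma intpart_walk a (N : nat) : `|a| <= 1 -> `|intpart (a * N%:R)| <= N%:Z.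
Proof.
move=> a1; rewrite -(norm_intr_le (R := R)).
rewrite (le_trans (intpart_bounds _).2)// normrM (ger0_norm (ler0n _ _)).
by rewrite ler_piMl.
Qed.

Lemma grows_like_near (u v : nat -> R) (g C : R) : grows_like u g ->
  (forall n, `|v n - u n| <= C) -> grows_like v g.
Proof.
move=> ug uv e e0; have e2 : 0 < e / 2 by rewrite divr_gt0.
have [N1 N1P] := ug _ e2; have [N2 N2P] := natr_large (C / (e / 2)).
exists (maxn N1 N2) => n; rewrite geq_max => /andP[/N1P h1 /N2P].
rewrite ler_pdivrMr// => h2.
rewrite -(subrK (u n) (v n)) -addrA; apply: (le_trans (ler_normD _ _)).
by have := uv n; lra.
Qed.

Lemma grows_like_intpart a : grows_like (fun N => (intpart (a * N%:R))%:~R) a.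
Proof.
apply: (@grows_like_near (fun N => a * N%:R) _ _ 1).
  by move=> e e0; exists 0%N => n _; rewrite subrr normr0 mulr_ge0// ltW.
by move=> n; exact: (intpart_bounds _).1.
Qed.

Definition has_rates A h := forall n (m : int), (0 < n)%N -> `|m| < n%:Z -> m != 0 ->
  grows_like (fun k => A (k * n)%N (k%:Z * m)) (h n m).

Definition approximates a eta n (m : int) :=
  [/\ (0 < n)%N, `|m| < n%:Z, m != 0 &
      `|a - m%:~R / n%:R| < (1 - `|m%:~R / n%:R|) * eta].

Lemma approximates_exists a eta : `|a| < 1 -> 0 < eta -> exists n m, approximates a eta n m.
Proof.
move=> a1 eta0; have d0 : 0 < 1 - `|a| by rewrite subr_gt0.
have [N /(_ N.+1 (leqnSn N))] := natr_large (3 / ((1 - `|a|) * Num.min eta 1)).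
have m0 : 0 < Num.min eta 1 by rewrite lt_min eta0 ltr01.
rewrite ler_pdivrMr ?mulr_gt0// => NP.
have n0 : 0 < N.+1%:R :> R by rewrite ltr0n.
(* Rounding away from 0 keeps [m] nonzero, also when [a = 0]. *)
have [m [mne mP]] : exists m : int, m != 0 /\ `|m%:~R - a * N.+1%:R| <= 1.
  have [a0|a0] := leP 0 a.
    exists (Num.floor (a * N.+1%:R) + 1); split.
      have : 0 <= Num.floor (a * N.+1%:R) by rewrite floor_ge0 mulr_ge0.
      by lia.
    have := floor_le (a * N.+1%:R); have := floorD1_gt (a * N.+1%:R).
    by rewrite intrD => h1 h2; rewrite ger0_norm; lra.
  exists (Num.floor (a * N.+1%:R)); split.
    have : Num.floor (a * N.+1%:R) < 0 by rewrite floor_lt0 nmulr_rlt0.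
    by lia.
  have := floor_le (a * N.+1%:R); have := floorD1_gt (a * N.+1%:R).
  by rewrite intrD => h1 h2; rewrite distrC ger0_norm; lra.
have ab : `|a - m%:~R / N.+1%:R| * N.+1%:R <= 1.
  have -> : `|a - m%:~R / N.+1%:R| * N.+1%:R = `|m%:~R - a * N.+1%:R|.
    rewrite -{2}(gtr0_norm n0) -normrM -normrN; congr `|_|; field.
    by rewrite gt_eqF.
  exact: mP.
exists N.+1, m; set b : R := m%:~R / N.+1%:R in ab *.
have min1 : Num.min eta 1 <= 1 by rewrite ge_min lexx orbT.
have mine : Num.min eta 1 <= eta by rewrite ge_min lexx.
move: (Num.min eta 1) m0 min1 mine NP => t t0 t1 te NP.
have close : 3 * `|a - b| <= (1 - `|a|) * t.
  rewrite -(ler_pM2r n0); rewrite mulrC in NP; lra.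
have tri : `|b| <= `|a| + `|a - b|.
  by rewrite -{1}(subrK a b) addrC (le_trans (ler_normD _ _))// distrC.
have dt : (1 - `|a|) * t <= 1 - `|a| by rewrite ler_piMr// ltW.
have pos : 0 < (1 - `|a|) * t by rewrite mulr_gt0.
have b1 : `|b| < 1 by lra.
split => //.
  move: b1; rewrite normrM normfV (gtr0_norm n0) ltr_pdivrMr// mul1r -intr_norm.
  by rewrite -[N.+1%:R]/(N.+1%:Z%:~R) ltr_int.
apply: (@lt_le_trans _ _ ((1 - `|b|) * t)); last by rewrite ler_wpM2l// subr_ge0 ltW.
have : `|a - b| * t <= `|a - b| by rewrite ler_piMr.
have : (1 - `|a| - `|a - b|) * t <= (1 - `|b|) * t by apply: ler_wpM2r; [exact: ltW|lra].
by lra.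
Qed.

(** The condition on the slope is open, so one direction serves a neighbourhood of slopes; the
    continuity of the rate comes from this. *)
Lemma approximates_near a eta n m : approximates a eta n m ->
  exists2 d : R, 0 < d & forall a', `|a' - a| < d -> approximates a' eta n m.
Proof.
move=> [n0 mn m0]; set b := _ / _ => ab.
exists ((1 - `|b|) * eta - `|a - b|) => [|a' aa']; first by rewrite subr_gt0.
split => //; rewrite -/b.
have : `|a' - b| <= `|a' - a| + `|a - b| by rewrite -{1}(subrK a a') -addrA ler_normD.
by lra.
Qed.

Variables (c : R) (h : nat -> int -> R) (A0 : nat -> int -> R).
Hypotheses (c0 : 0 <= c) (A0_ext : extendable c A0) (A0_rates : has_rates A0 h).

Let M : R := 4 * c + 2.

Let M0 : 0 < M. Proof. by rewrite ltr_wpDl// mulr_ge0. Qed.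

(** Each approximating direction confines the rate to an interval of radius [M eta]. Any two of
    these intervals meet, since both contain [A0 N (intpart (a N)) / N] for large [N], so the
    supremum of the left ends lies in all of them. *)
Let rate_exists a : `|a| < 1 -> exists L, forall eta n m, 0 < eta -> eta <= 1 / 2 ->
  approximates a eta n m -> `|L - h n m / n%:R| <= M * eta.
Proof.
move=> a1.
pose V := [set v : R | exists eta n m, [/\ 0 < eta, eta <= 1 / 2, approximates a eta n m &
                                          v = h n m / n%:R - M * eta]].
have VV eta n m eta' n' m' : 0 < eta -> eta <= 1 / 2 -> approximates a eta n m ->
    0 < eta' -> eta' <= 1 / 2 -> approximates a eta' n' m' ->
    h n m / n%:R - M * eta <= h n' m' / n'%:R + M * eta'.
  move=> e0 e1 [n0 mn m0 ab] e0' e1' [n0' mn' m0' ab'].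
  have y1 N := intpart_walk N (ltW a1).
  have [N1 h1] := direction_comparison c0 n0 mn e0 e1 ab A0_ext
                    (A0_rates n0 mn m0) y1 (grows_like_intpart a).
  have [N2 h2] := direction_comparison c0 n0' mn' e0' e1' ab' A0_ext
                    (A0_rates n0' mn' m0') y1 (grows_like_intpart a).
  pose N := (maxn N1 N2).+1; have Np : 0 < N%:R :> R by rewrite ltr0n.
  have := h2 N (leq_trans (leq_maxr _ _) (leqnSn _)).
  have := h1 N (leq_trans (leq_maxl _ _) (leqnSn _)).
  rewrite !ler_norml => /andP[h3 h4] /andP[h5 h6].
  by rewrite -(ler_pM2r Np) /M; lra.
have V0 : V !=set0.
  have [n [m nm]] := approximates_exists a1 (eta := 1 / 2) ltac:(by []).
  by exists (h n m / n%:R - M * (1 / 2)), (1 / 2), n, m.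
exists (sup V) => eta n m e0 e1 nm; rewrite ler_norml; apply/andP; split.
  rewrite lerBrDr addrC; apply: sup_ubound; last by exists eta, n, m.
  exists (h n m / n%:R + M * eta) => _ [eta' [n' [m' [e0' e1' nm' ->]]]].
  exact: VV.
rewrite lerBlDr addrC; apply: ge_sup => // _ [eta' [n' [m' [e0' e1' nm' ->]]]].
exact: VV.
Qed.

(** [A0] serves to construct [L], whereas the first clause covers every [A] with the same rates [h].
    With the mean cost as [A0] and the cost in a typical environment as [A], the random limit is
    seen to be deterministic. *)
Lemma directional_rate : exists L : R -> R,
  (forall A y a, extendable c A -> has_rates A h -> `|a| < 1 ->
    (forall N, `|y N| <= N%:Z) -> grows_like (fun N => (y N)%:~R) a ->
    grows_like (fun N => A N (y N)) (L a)) /\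
  (forall a, `|a| < 1 -> forall eps : R, 0 < eps ->
    exists2 d : R, 0 < d & forall a', `|a' - a| < d -> `|L a' - L a| <= eps).
Proof.
have /choice[L LP] a : exists L, `|a| < 1 -> forall eta n m, 0 < eta -> eta <= 1 / 2 ->
  approximates a eta n m -> `|L - h n m / n%:R| <= M * eta.
  have [/rate_exists[L LP]|a1] := ltP `|a| 1; [by exists L|].
  by exists 0.
have small eps : 0 < eps -> exists eta, [/\ 0 < eta, eta <= 1 / 2 & 2 * (M * eta) <= eps].
  move=> e0; exists (Num.min (1 / 2) (eps / (2 * M))).
  rewrite lt_min ge_min lexx divr_gt0//= divr_gt0 ?mulr_gt0//; split => //.
  rewrite mulrA mulrC -ler_pdivlMr ?mulr_gt0//.
  by rewrite ge_min lexx orbT.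
exists L; split => [A y a Aext Ar a1 yN ya eps eps0|a a1 eps eps0].
  have [eta [e0 e1 e2]] := small _ eps0.
  have [n [m nm]] := approximates_exists a1 e0; have LP' := LP _ a1 _ _ _ e0 e1 nm.
  have [n0 mn m0 ab] := nm.
  have [N1 N1P] := direction_comparison c0 n0 mn e0 e1 ab Aext (Ar _ _ n0 mn m0) yN ya.
  exists N1 => N /N1P h1.
  have Np : 0 <= N%:R :> R by [].
  have -> : A N (y N) - L a * N%:R =
    (A N (y N) - h n m / n%:R * N%:R) - (L a - h n m / n%:R) * N%:R by ring.
  apply: (le_trans (ler_normB _ _)); rewrite normrM (ger0_norm Np).
  have := ler_wpM2r Np LP'; have := ler_wpM2r Np e2; move: h1; rewrite -/M; lra.
have [eta [e0 e1 e2]] := small _ eps0.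
have [n [m nm]] := approximates_exists a1 e0.
have [d d0 dP] := approximates_near nm.
exists (Num.min d (1 - `|a|)); first by rewrite lt_min d0 subr_gt0.
move=> a'; rewrite lt_min => /andP[/dP nm' a'a].
have a'1 : `|a'| < 1.
  have : `|a'| <= `|a' - a| + `|a| by rewrite -{1}(subrK a a') ler_normD.
  by lra.
have -> : L a' - L a = (L a' - h n m / n%:R) - (L a - h n m / n%:R) by ring.
apply: (le_trans (ler_normB _ _)).
by have := LP _ a'1 _ _ _ e0 e1 nm'; have := LP _ a1 _ _ _ e0 e1 nm; lra.
Qed.

End DirectionalRate.

(** * The random environment *)

Section Environment.
Context {R : realType}.
Variables (c : R) (c0 : 0 < c).

Local Notation env := (coord_space (int + int)%type R).

(* On the almost sure event where [|F| <= c] and [|B| = 1] the truncation is inactive; it makes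
   the field bounded everywhere. *)
Definition truncate (r : R) : R := Num.max (- c) (Num.min c r).

Definition env_field (w : env) : nat -> int -> R :=
  fun i y => truncate (w (inr i%:Z) * w (inl y)).

Definition env_cost (t : nat) (y : int) (w : env) : R := min_cost (env_field w) t y.

Lemma truncate_id r : `|r| <= c -> truncate r = r.
Proof. by rewrite ler_norml /truncate => /andP[h1 h2]; rewrite min_r// max_r. Qed.

Lemma truncate_norm r : `|truncate r| <= c.
Proof.
have c0' := c0; rewrite ler_norml /truncate le_max lexx /= ge_max ge_min lexx /= andbT.
by lra.
Qed.

Lemma truncateN r : truncate (- r) = - truncate r.
Proof.
have c0' := c0; rewrite /truncate !minEle.
by case: (leP c r) => h1; case: (leP c (- r)) => h2; rewrite !maxEle;
   do ? case: leP => ?; lra.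
Qed.

Lemma env_field_bounded w : field_bounded c (env_field w).
Proof. by move=> i y; exact: truncate_norm. Qed.

Lemma measurable_env_field i y : measurable_fun setT (fun w : env => env_field w i y).
Proof.
apply: measurable_maxr; first exact: measurable_cst.
apply: (measurable_minr (f := fun=> c)); first exact: measurable_cst.
by apply: measurable_funM; exact: measurable_coord.
Qed.

Lemma bounded_measurable_env_field i y :
  bounded_measurable (fun w : env => env_field w i y).
Proof.
by split; [exact: measurable_env_field | exists c => w; exact: env_field_bounded].
Qed.

(** Walks are functions on all of [nat], an uncountable type; finite sequences are countable, so the
    event that the infimum lies below a level becomes a countable union. *)
Lemma lazy_walk_finite t x g : lazy_walk t x g ->
  exists2 s : seq int, lazy_walk t x (nth 0 s) & forall i, (i <= t)%N -> nth 0 s i = g i.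
Proof.
move=> [g0 [gt gS]]; have nthE i : (i <= t)%N -> nth 0 (mkseq g t.+1) i = g i.
  by move=> it; rewrite nth_mkseq.
exists (mkseq g t.+1) => //; split; first by rewrite nthE.
by split=> [|i it]; [rewrite nthE | rewrite (nthE i (ltnW it)) nthE//; exact: gS].
Qed.

Lemma bounded_measurable_env_cost t y : `|y| <= t%:Z -> bounded_measurable (env_cost t y).
Proof.
move=> yt; split; last first.
  by exists (c * t%:R) => w; apply: min_cost_norm => //; exact: env_field_bounded.
have [g0 g0w] := lazy_walk_exists yt.
move=> mT; apply: (measurability _ (RGenInftyO.measurableE R)) => // _ [_ [r ->] <-].
rewrite setTI.
have -> : env_cost t y @^-1` `]-oo, r[ = \bigcup_(s : seq int)
    (if pselect (lazy_walk t y (nth 0 s)) then [set w | walk_cost (env_field w) t (nth 0 s) < r]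
     else set0).
  apply/seteqP; split => w /=; rewrite in_itv /=.
    move=> /inf_lt[]; first by exists (walk_cost (env_field w) t g0), g0.
    move=> _ [g /lazy_walk_finite[s sw sg] <-] gr; exists s => //.
    case: pselect => //= _; rewrite (le_lt_trans _ gr)// le_eqVlt; apply/orP; left; apply/eqP.
    by apply: eq_big_nat => i /andP[_ it]; rewrite sg.
  move=> [s _]; case: pselect => //= sw; apply: le_lt_trans.
  by apply: min_cost_le sw; exact: env_field_bounded.
apply: countable_bigcupT_measurable; first exact: countableP.
move=> s; case: pselect => //= _.
have mW : measurable_fun setT (fun w : env => walk_cost (env_field w) t (nth 0 s)).
  by case: (bounded_measurable_sum (index_iota 1 t.+1)
    (fun i => bounded_measurable_env_field i (nth 0 s i))).
have := mW measurableT _ (measurable_itv `]-oo, r[).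
by rewrite setTI; congr measurable; apply/seteqP; split=> w /=; rewrite in_itv.
Qed.

Definition shift_index (s : nat) (x : int) (k : int + int) : int + int :=
  match k with inl y => inl (x + y) | inr i => inr (s%:Z + i) end.

Definition unshift_index (s : nat) (x : int) (k : int + int) : int + int :=
  match k with inl y => inl (y - x) | inr i => inr (i - s%:Z) end.

Lemma shift_indexK s x : cancel (shift_index s x) (unshift_index s x).
Proof. by case=> i /=; rewrite addrC addKr. Qed.

Definition shift_env s x (w : env) : env := fun k => w (shift_index s x k).

Lemma measurable_shift_env s x : measurable_fun setT (shift_env s x).
Proof. by apply: measurable_fun_coord_space => k; exact: measurable_coord. Qed.

Lemma env_cost_extendable w : extendable c (fun n x => env_cost n x w).
Proof.
have wb := env_field_bounded w; split=> [n x xn|s t x z xs zt]; first exact: min_cost_norm.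
apply: (le_trans (min_cost_subadditive wb xs zt)); rewrite lerD2l.
apply: (le_trans (ler_norm _)); apply: min_cost_norm => //; exact: shift_field_bounded.
Qed.

Context {d} {T : measurableType d} (P : probability T R).
Variable X : (int + int)%type -> T -> R.
Hypothesis mX : forall k, measurable_fun setT (X k).
Hypothesis indX : mutually_independent P X.
Hypothesis identF : forall x y A, measurable A -> P (X (inl x) @^-1` A) = P (X (inl y) @^-1` A).
Hypothesis identB : forall i j A, measurable A -> P (X (inr i) @^-1` A) = P (X (inr j) @^-1` A).
Hypothesis symB : forall i (A : set R), measurable A ->
  P (X (inr i) @^-1` ((fun r => - r) @^-1` A)) = P (X (inr i) @^-1` A).

Definition mean_cost (n : nat) (x : int) : R := \int[P]_u env_cost n x (joint X u).

Let bm_joint (f : env -> R) : bounded_measurable f ->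
  bounded_measurable (fun u => f (joint X u)).
Proof. exact: (bounded_measurable_comp (measurable_joint mX)). Qed.

Lemma expect_shift s x (f : env -> R) : bounded_measurable f ->
  \int[P]_u f (shift_env s x (joint X u)) = \int[P]_u f (joint X u).
Proof.
apply: (joint_transform_expect mX indX (shift_indexK s x) (phi := fun=> id)) => //.
by move=> [y|i] A mA; [exact: identF|exact: identB].
Qed.

Definition reflect_env (w : env) : env := fun k =>
  match k with inl y => w (inl (- y)) | inr i => w (inr i) end.

Lemma expect_reflect (f : env -> R) : bounded_measurable f ->
  \int[P]_u f (reflect_env (joint X u)) = \int[P]_u f (joint X u).
Proof.
pose s (k : (int + int)%type) : (int + int)%type :=
  match k with inl y => inl (- y) | inr i => inr i end.
have sK : cancel s s by case=> i //=; rewrite opprK.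
move=> mf; rewrite -[RHS](joint_transform_expect mX indX sK (phi := fun=> id) _ _ mf)//.
  by congr Rintegral; apply/funext => u; congr f; apply/funext => -[].
by move=> [y|i] A mA; [exact: identF|exact: identB].
Qed.

Definition flip_coin (j : int) (w : env) : env := fun k =>
  match k with inl y => w (inl y) | inr i => if i == j then - w (inr i) else w (inr i) end.

Lemma expect_flip j (f : env -> R) : bounded_measurable f ->
  \int[P]_u f (flip_coin j (joint X u)) = \int[P]_u f (joint X u).
Proof.
move=> mf; pose phi (k : (int + int)%type) (r : R) : R :=
  match k with inl y => r | inr i => if i == j then - r else r end.
have mphi k : measurable_fun setT (phi k).
  by case: k => // i; rewrite /phi; case: (i == j) => //; exact: measurableT_comp.
have phiX k A : measurable A -> P (X k @^-1` (phi k @^-1` A)) = P (X k @^-1` A).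
  by case: k => // i mA; rewrite /phi; case: (i == j) => //; exact: symB.
have idK : cancel id (id : (int + int)%type -> (int + int)%type) by [].
rewrite -[RHS](joint_transform_expect mX indX idK mphi phiX mf).
by congr Rintegral; apply/funext => u; congr f; apply/funext => -[].
Qed.

Lemma env_field_flip (j : nat) w i y :
  env_field (flip_coin j%:Z w) i y = (if i == j then -1 else 1) * env_field w i y.
Proof.
rewrite /env_field /= eqz_nat; case: ifP => _; rewrite ?mul1r// mulN1r -truncateN.
by rewrite mulNr.
Qed.

Lemma mean_cost_extendable : extendable c mean_cost.
Proof.
split=> [n x xn|s t x z xs zt].
  have bm := bm_joint (bounded_measurable_env_cost xn).
  have nb u := (env_cost_extendable (joint X u)).1 n x xn.
  rewrite ler_norml; apply/andP; split.
    rewrite -[leLHS](expect_cst P); apply: expect_le => // [|u].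
      exact: bounded_measurable_cst.
    by have := nb u; rewrite ler_norml => /andP[].
  rewrite -[leRHS](expect_cst P); apply: expect_le => // [|u].
    exact: bounded_measurable_cst.
  by have := nb u; rewrite ler_norml => /andP[].
have xz : `|x + z| <= (s + t)%:Z by lia.
rewrite /mean_cost -[X in _ <= _ + X](expect_cst P) -expectD.
- apply: expect_le; first exact/bm_joint/bounded_measurable_env_cost.
    apply: bounded_measurableD; last exact: bounded_measurable_cst.
    exact/bm_joint/bounded_measurable_env_cost.
  by move=> u; exact: (env_cost_extendable _).2.
- exact/bm_joint/bounded_measurable_env_cost.
- exact: bounded_measurable_cst.
Qed.

Lemma mean_cost_subadditive s t x z : `|x| <= s%:Z -> `|z| <= t%:Z ->
  mean_cost (s + t) (x + z) <= mean_cost s x + mean_cost t z.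
Proof.
move=> xs zt; have xz : `|x + z| <= (s + t)%:Z by lia.
have bz := bounded_measurable_env_cost zt.
rewrite {3}/mean_cost -(expect_shift s x bz) /mean_cost -expectD.
- apply: expect_le; first exact/bm_joint/bounded_measurable_env_cost.
    apply: bounded_measurableD; first exact/bm_joint/bounded_measurable_env_cost.
    apply: (bm_joint (f := env_cost t z \o shift_env s x)).
    exact: (bounded_measurable_comp (measurable_shift_env _ _)).
  by move=> u; apply: (min_cost_subadditive (env_field_bounded _)).
- exact/bm_joint/bounded_measurable_env_cost.
- apply: (bm_joint (f := env_cost t z \o shift_env s x)).
  exact: (bounded_measurable_comp (measurable_shift_env _ _)).
Qed.

Lemma mean_cost_even n x : `|x| <= n%:Z -> mean_cost n (- x) = mean_cost n x.
Proof.
move=> xn; rewrite /mean_cost -(expect_reflect (bounded_measurable_env_cost xn)).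
by congr Rintegral; apply/funext => u; rewrite /env_cost -min_cost_reflect.
Qed.

(** Flipping the coin of time [i] preserves the law and changes the sign of the field, the
    truncation being odd. *)
Lemma mean_field0 i y : \int[P]_u env_field (joint X u) i y = 0.
Proof.
have bf := bounded_measurable_env_field i y.
have := expect_flip i%:Z bf.
under eq_Rintegral do rewrite env_field_flip eqxx.
rewrite expectZ; last exact: (bm_joint bf).
by rewrite mulN1r => h; lra.
Qed.

Lemma mean_cost_diag n : mean_cost n n%:Z = 0.
Proof.
rewrite /mean_cost; under eq_Rintegral do rewrite /env_cost min_cost_diag.
rewrite expect_sum ?big1// => [i _|i]; first exact: mean_field0.
by apply: (bm_joint (f := fun w => env_field w i i%:Z)); exact: bounded_measurable_env_field.
Qed.

Section Direction.
Variables (n : nat) (m : int).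
Hypotheses (n0 : (0 < n)%N) (mn : `|m| <= n%:Z) (m0 : m != 0).

Let Phi i u : env := shift_env (i * n) (i%:Z * m) (joint X u).
Let x l (w : env) : R := env_cost (l * n) (l%:Z * m) w.

Let lm l : `|l%:Z * m| <= (l * n)%:Z.
Proof. by rewrite normrM ger0_norm// PoszM ler_wpM2l. Qed.

Let Phi_add i l u : Phi (i + l) u = shift_env (l * n) (l%:Z * m) (Phi i u).
Proof.
apply/funext => -[y|j]; rewrite /Phi /shift_env /shift_index; congr joint.
  by congr inl; rewrite PoszD mulrDl addrA.
by congr inr; rewrite mulnDl PoszD addrA.
Qed.

Let inside l i (k : (int + int)%type) : bool :=
  match k with inl y => `|y - i%:Z * m| <= (l * n)%:Z
             | inr j => ((i * n)%:Z < j) && (j <= ((i + l) * n)%:Z) end.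

Let x_local l i w w' : (forall k, inside l i k -> w k = w' k) ->
  x l (shift_env (i * n) (i%:Z * m) w) = x l (shift_env (i * n) (i%:Z * m) w').
Proof.
move=> ww'; apply: eq_min_cost => t y /andP[t1 tl] yt; rewrite /env_field /shift_env /=.
rewrite (ww' (inl (i%:Z * m + y))); last first.
  by rewrite /= [i%:Z * m + y]addrC addrK (le_trans yt).
rewrite (ww' (inr ((i * n)%:Z + t%:Z)))//= mulnDl.
by apply/andP; split; lia.
Qed.

(** The sites read by the two blocks are centred at distance [(j - i) |m| >= j - i > 2 l n], and
    their times are disjoint once [j >= i + l]. This is where [m != 0] enters. *)
Let x_dep l : exists K, forall i j, (i + K <= j)%N ->
  \int[P]_u (x l (Phi i u) * x l (Phi j u)) = \int[P]_u x l (Phi i u) * \int[P]_u x l (Phi j u).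
Proof.
exists (2 * (l * n) + l + 1)%N => i j ij.
have bx a : bounded_measurable (x l \o shift_env (a * n) (a%:Z * m)).
  apply: bounded_measurable_comp; first exact: measurable_shift_env.
  exact/bounded_measurable_env_cost.
apply: (joint_expectM mX indX (S := inside l i) (bx i) (bx j)) => w w' ww'.
  exact: x_local.
apply: x_local => k kj; apply: ww'; case: k kj => [y|t] /=.
  move=> yj; apply/negP => yi.
  have : `|(j%:Z - i%:Z) * m| <= (l * n)%:Z + (l * n)%:Z.
    have -> : (j%:Z - i%:Z) * m = (y - i%:Z * m) - (y - j%:Z * m) by ring.
    by rewrite (le_trans (ler_normB _ _))// lerD.
  have ji : 0 <= j%:Z - i%:Z by rewrite subr_ge0 lez_nat; lia.
  rewrite normrM ger0_norm//.
  have : j%:Z - i%:Z <= (j%:Z - i%:Z) * `|m| by rewrite ler_peMr//; lia.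
  by move: ij; clear; move: (l * n)%N => q; lia.
move=> /andP[tj _]; rewrite negb_and; apply/orP; right; rewrite -ltNge.
apply: le_lt_trans tj; rewrite lez_nat leq_mul2r; apply/orP; right; lia.
Qed.

Lemma direction_ergodic : exists g,
  grows_like (fun k => mean_cost (k * n) (k%:Z * m)) g /\
  {ae P, forall u, grows_like (fun k => env_cost (k * n) (k%:Z * m) (joint X u)) g}.
Proof.
have mPhi i : measurable_fun setT (Phi i).
  exact: (measurableT_comp (measurable_shift_env _ _) (measurable_joint mX)).
have bx l : bounded_measurable (x l) by exact/bounded_measurable_env_cost.
have xC l w : `|x l w| <= c * n%:R * l%:R.
  by rewrite -mulrA -natrM mulnC; exact: (env_cost_extendable w).1.
have sub i l l' u : x (l + l')%N (Phi i u) <= x l (Phi i u) + x l' (Phi (i + l)%N u).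
  rewrite Phi_add /x mulnDl PoszD mulrDl.
  exact: (min_cost_subadditive (env_field_bounded _)).
have stat i (f : env -> R) : bounded_measurable f ->
    \int[P]_u f (Phi i u) = \int[P]_u f (Phi 0%N u).
  by move=> mf; rewrite !expect_shift.
have Phi0 u : Phi 0%N u = joint X u.
  by apply/funext => -[y|j]; rewrite /Phi /shift_env /= ?mul0n ?mul0r add0r.
have [g [_ mean_g ae_g]] :=
  subadditive_ergodic mPhi (fun l => (bx l).1) xC sub stat x_dep.
exists g; split.
  rewrite (_ : (fun k => _) = (fun l => \int[P]_u x l (Phi 0%N u)))//.
  by apply/funext => k; apply: eq_Rintegral => u _; rewrite Phi0.
move: ae_g; apply: filterS => u.
rewrite (_ : (fun k => env_cost _ _ _) = (fun l => x l (Phi 0%N u)))//.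
by apply/funext => k; rewrite Phi0.
Qed.

End Direction.

(** * Exponential moments and the mean cost near slope 1 *)

Lemma cosh_le (s : R) : `|s| <= 1 / 2 -> expR (- s) + expR s <= 2 * expR (2 * s ^+ 2).
Proof.
rewrite ler_norml => /andP[s1 s2].
have exp_le (r : R) : r < 1 -> expR r <= (1 - r)^-1.
  move=> r1; rewrite -[r]opprK expRN lef_pV2 ?posrE ?expR_gt0 ?subr_gt0 ?opprK//.
  exact: expR_ge1Dx.
have h1 : expR s <= (1 - s)^-1 by apply: exp_le; lra.
have h2 : expR (- s) <= (1 + s)^-1 by rewrite -[X in 1 + X]opprK; apply: exp_le; lra.
have h3 : 1 + 2 * s ^+ 2 <= expR (2 * s ^+ 2) by exact: expR_ge1Dx.
have p1 : 0 < 1 - s by lra.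
have p2 : 0 < 1 + s by lra.
apply: (le_trans (lerD h2 h1)).
apply: (@le_trans _ _ (2 * (1 + 2 * s ^+ 2))); last by rewrite ler_pM2l.
have -> : (1 + s)^-1 + (1 - s)^-1 = 2 / ((1 + s) * (1 - s)) by field; rewrite !gt_eqF.
rewrite ler_pdivrMr ?mulr_gt0// -mulrA ler_peMr//.
have ss : s ^+ 2 <= 1 / 4 by rewrite expr2; nra.
have -> : (1 + 2 * s ^+ 2) * ((1 + s) * (1 - s)) = 1 + s ^+ 2 * (1 - 2 * s ^+ 2) by ring.
by rewrite lerDl mulr_ge0 ?sqr_ge0//; lra.
Qed.

Section PartitionFunction.
Variables (th q : R).
Hypotheses (th0 : 0 < th) (thc : th * c <= 1 / 2) (q0 : 0 <= q).

(** [E1] is the generating function of one lazy step under the tilt [q], and [E2] bounds the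
    hyperbolic cosine of one coin. The tilt turns the prescribed endpoint into the factor
    [expR (- q * y)], which limits the number of walks of slope near 1. *)
Let E1 : R := expR q + 1 + expR (- q).
Let E2 : R := expR (2 * (th * c) ^+ 2).

Let weight_bounded i y (e : R) : `|e| = th ->
  bounded_measurable (fun w : env => expR (e * env_field w i y)).
Proof.
move=> eth; split.
  apply: measurableT_comp => //; apply: measurable_funM => //.
  exact: measurable_env_field.
exists (expR (th * c)) => w; rewrite ger0_norm ?expR_ge0// ler_expR.
rewrite (le_trans (ler_norm _))// normrM eth ler_pM2l//; exact: env_field_bounded.
Qed.

Let bounded_partition t y : bounded_measurable (fun w => partition_fun th (env_field w) t y).
Proof.
elim: t y => [|t IH] y /=; first exact: bounded_measurable_cst.
apply: bounded_measurableM; first by apply: weight_bounded; rewrite normrN gtr0_norm.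
by apply: bounded_measurableD => //; exact: bounded_measurableD.
Qed.

(* Flipping the coin of time [t + 1] replaces its weight by the average, a hyperbolic cosine. *)
Lemma mean_partition_le t y :
  \int[P]_u partition_fun th (env_field (joint X u)) t y <= expR (- q * y%:~R) * (E1 * E2) ^+ t.
Proof.
have E10 : 0 <= E1 by rewrite !addr_ge0 ?expR_ge0.
elim: t y => [|t IH] y.
  rewrite /= expect_cst expr0 mulr1; case: eqP => [->|_]; last exact: expR_ge0.
  by rewrite mulr0 expR0.
pose G (w : env) : R := partition_fun th (env_field w) t (y - 1) +
  partition_fun th (env_field w) t y + partition_fun th (env_field w) t (y + 1).
have bG : bounded_measurable G by apply: bounded_measurableD => //; exact: bounded_measurableD.
have G0 w : 0 <= G w by rewrite !addr_ge0 ?partition_fun_ge0.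
pose W (e : R) (w : env) : R := expR (e * env_field w t.+1 y).
have bW (e : R) : `|e| = th -> bounded_measurable (W e) by exact: weight_bounded.
have bNth : `|- th| = th by rewrite normrN gtr0_norm.
have bth : `|th| = th by rewrite gtr0_norm.
have bWG (e : R) : `|e| = th -> bounded_measurable (fun w => W e w * G w).
  by move=> eth; apply: bounded_measurableM => //; exact: bW.
have flipped : \int[P]_u (W th (joint X u) * G (joint X u)) =
               \int[P]_u (W (- th) (joint X u) * G (joint X u)).
  rewrite -(expect_flip t.+1%:Z (bWG _ bNth)).
  apply: eq_Rintegral => u _; congr (_ * _).
    by rewrite /W env_field_flip eqxx mulrA mulrN1 opprK.
  (* [G] depends only on the coins of times up to [t], so the flip at [t + 1] leaves it
     unchanged. *)
  have same z : partition_fun th (env_field (joint X u)) t z =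
      partition_fun th (env_field (flip_coin t.+1%:Z (joint X u))) t z.
    apply: eq_partition_fun => i z' /andP[_ it].
    by rewrite env_field_flip (_ : (i == t.+1) = false) ?mul1r//; lia.
  by rewrite /G !same.
have half : 2 * \int[P]_u (W (- th) (joint X u) * G (joint X u)) <=
    2 * E2 * \int[P]_u G (joint X u).
  rewrite mulr2n mulrDl mul1r -{1}flipped -expectD; last 2 first.
  - exact: (bm_joint (bWG _ bth)).
  - exact: (bm_joint (bWG _ bNth)).
  rewrite -expectZ; last exact: (bm_joint bG).
  apply: expect_le.
  - by apply: bounded_measurableD; [exact: (bm_joint (bWG _ bth))|exact: (bm_joint (bWG _ bNth))].
  - exact/bounded_measurableZ/(bm_joint bG).
  move=> u; rewrite -mulrDl ler_wpM2r//.
  have vc := env_field_bounded (joint X u) t.+1 y.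
  have thv : `|th * env_field (joint X u) t.+1 y| <= th * c.
    by rewrite normrM (gtr0_norm th0) ler_pM2l.
  have := cosh_le (le_trans thv thc); rewrite addrC /W mulNr => /le_trans; apply.
  rewrite ler_pM2l// ler_expR ler_pM2l//.
  by rewrite -(real_normK (num_real (th * _))) ler_sqr ?nnegrE// (le_trans _ thv).
have -> : \int[P]_u partition_fun th (env_field (joint X u)) t.+1 y =
          \int[P]_u (W (- th) (joint X u) * G (joint X u)) by [].
have GE : \int[P]_u G (joint X u) <=
    expR (- q * y%:~R) * E1 * (E1 * E2) ^+ t.
  rewrite /G expectD; last 2 first.
  - by apply: bounded_measurableD; exact: (bm_joint (bounded_partition _ _)).
  - exact: (bm_joint (bounded_partition _ _)).
  rewrite expectD; try exact: (bm_joint (bounded_partition _ _)).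
  apply: (le_trans (lerD (lerD (IH _) (IH _)) (IH _))).
  rewrite -!mulrDl ler_wpM2r ?exprn_ge0 ?mulr_ge0 ?expR_ge0// /E1.
  rewrite !mulrDr mulr1 -!expRD !intrD mulrDr mulrDr.
  rewrite le_eqVlt; apply/orP; left; apply/eqP.
  by congr (expR _ + _ + expR _); rewrite ?mulrN ?mulr1 ?opprK// mulrNz /=; ring.
have E20 : 0 <= E2 by exact: expR_ge0.
have := ler_wpM2l E20 GE; rewrite exprS; lra.
Qed.

Lemma mean_cost_lower t y : `|y| <= t%:Z ->
  - (q * (t%:R - y%:~R) + t%:R * (2 * expR (- q) + 2 * (th * c) ^+ 2)) / th <= mean_cost t y.
Proof.
move=> yt; set Y := q * _ + _.
(* Factoring out [expR q] leaves [1 + expR (- q) + expR (- 2 q)], which is at most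
   [expR (2 expR (- q))]: for large [q] the excess over [q] per step is exponentially small. *)
have E1E2 : E1 * E2 <= expR (q + 2 * expR (- q) + 2 * (th * c) ^+ 2).
  rewrite expRD ler_wpM2r ?expR_ge0//.
  have -> : E1 = expR q * (1 + (expR (- q) + expR (- q) * expR (- q))).
    rewrite /E1 !mulrDr mulr1 mulrA -expRD subrr expR0 mul1r; ring.
  rewrite expRD ler_pM2l ?expR_gt0//; apply: le_trans (expR_ge1Dx _).
  rewrite lerD2l mulr2n mulrDl mul1r lerD2l ler_piMr ?expR_ge0//.
  by rewrite -[leRHS]expR0 ler_expR oppr_le0.
have EZ : \int[P]_u partition_fun th (env_field (joint X u)) t y <= expR Y.
  apply: (le_trans (mean_partition_le t y)).
  have -> : expR Y = expR (- q * y%:~R) *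
      expR (q + 2 * expR (- q) + 2 * (th * c) ^+ 2) ^+ t.
    by rewrite -expRM_natl -expRD; congr expR; rewrite /Y; ring.
  rewrite ler_pM2l ?expR_gt0// lerXn2r ?nnegrE ?expR_ge0//.
  by rewrite mulr_ge0 ?expR_ge0// !addr_ge0 ?expR_ge0.
(* In place of Jensen's inequality for the logarithm, [1 + z <= expR z] is used at
   [z = - th * cost - Y]. As [expR Y] dominates the mean partition function, integration gives
   [- Y / th]. *)
have pointwise u : - (Y - 1) / th + (- expR (- Y) / th) *
    partition_fun th (env_field (joint X u)) t y <= env_cost t y (joint X u).
  apply: le_min_cost => // g gw.
  have h := partition_fun_ge th (env_field (joint X u)) gw.
  have := expR_ge1Dx (- th * walk_cost (env_field (joint X u)) t g - Y).
  rewrite expRD => h'.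
  have := ler_wpM2r (expR_ge0 (- Y)) h; move: (partition_fun _ _ _ _) (walk_cost _ _ _) h h'.
  move=> z s h h' h''; rewrite -(ler_pM2l th0) mulrDr.
  have -> : th * (- (Y - 1) / th) = - (Y - 1) by field; rewrite gt_eqF.
  have -> : th * (- expR (- Y) / th * z) = - (z * expR (- Y)) by field; rewrite gt_eqF.
  by lra.
have bZ := bm_joint (bounded_partition t y).
apply: le_trans (expect_le P _ (bm_joint (bounded_measurable_env_cost yt)) pointwise).
  rewrite expectD; [|exact: bounded_measurable_cst|exact: bounded_measurableZ].
  rewrite expect_cst expectZ// -(ler_pM2l th0) mulrDr.
  have -> z : th * (- expR (- Y) / th * z) = - (expR (- Y) * z) by field; rewrite gt_eqF.
  have -> : th * (- Y / th) = - Y by field; rewrite gt_eqF.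
  have -> : th * (- (Y - 1) / th) = - (Y - 1) by field; rewrite gt_eqF.
  have := ler_wpM2l (expR_ge0 (- Y)) EZ; rewrite -expRD addNr expR0; lra.
by apply: bounded_measurableD; [exact: bounded_measurable_cst|exact: bounded_measurableZ].
Qed.

End PartitionFunction.
End Environment.

(** * The shape function *)

Section RateLemmas.
Context {R : realType}.

Lemma grows_like_unique (f : nat -> R) g g' : grows_like f g -> grows_like f g' -> g = g'.
Proof.
by move=> /grows_like_cvg fg /grows_like_cvg; apply: cvg_unique.
Qed.

(** [C] collects the finitely many indices below the threshold, so the bound holds at every [n], in
    particular at the lengths of both pieces of a concatenated walk. *)
Lemma grows_like_affine (f : nat -> R) g : grows_like f g -> forall e : R, 0 < e ->
  exists C, forall n, `|f n - g * n%:R| <= e * n%:R + C.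
Proof.
move=> fg e e0; have [N NP] := fg _ e0.
exists (\sum_(0 <= k < N) `|f k - g * k%:R|) => n.
have S0 : 0 <= \sum_(0 <= k < N) `|f k - g * k%:R| by exact: sumr_ge0.
have [Nn|nN] := leqP N n; first by rewrite (le_trans (NP _ Nn))// lerDl.
rewrite (big_rem n) ?mem_index_iota//=.
have : 0 <= \sum_(k <- rem n (index_iota 0 N)) `|f k - g * k%:R| by exact: sumr_ge0.
have : 0 <= e * n%:R by rewrite mulr_ge0// ltW.
lra.
Qed.

Lemma ae_forall_countable {d} {T : measurableType d} (P : probability T R) (I : countType)
  (Q : I -> T -> Prop) : (forall i, {ae P, forall u, Q i u}) ->
  {ae P, forall u, forall i, Q i u}.
Proof.
move=> aeQ.
have /ae_foralln : forall n, {ae P, forall u, if unpickle n is Some i then Q i u else True}.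
  by move=> n; case: unpickle => [i|]; [exact: aeQ | apply: aeW].
by apply: filterS => u Qu i; have := Qu (pickle i); rewrite pickleK.
Qed.

End RateLemmas.

Section Shape.
Context {R : realType}.
Variables (c : R) (c0 : 0 < c).
Context {d} {T : measurableType d} (P : probability T R).
Variable X : (int + int)%type -> T -> R.
Hypothesis mX : forall k, measurable_fun setT (X k).
Hypothesis indX : mutually_independent P X.
Hypothesis identF : forall x y A, measurable A -> P (X (inl x) @^-1` A) = P (X (inl y) @^-1` A).
Hypothesis identB : forall i j A, measurable A -> P (X (inr i) @^-1` A) = P (X (inr j) @^-1` A).
Hypothesis symB : forall i (A : set R), measurable A ->
  P (X (inr i) @^-1` ((fun r => - r) @^-1` A)) = P (X (inr i) @^-1` A).

Let e := mean_cost c P X.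

Section Profile.
Variable Lam : R -> R.
Hypothesis mean_rate : forall a, `|a| <= 1 ->
  grows_like (fun N => e N (intpart (a * N%:R))) (- Lam a).

Lemma profile_even a : `|a| <= 1 -> Lam (- a) = Lam a.
Proof.
move=> a1; apply: oppr_inj; apply: grows_like_unique (mean_rate a1).
have := mean_rate (a := - a); rewrite normrN => /(_ a1).
rewrite (_ : (fun N => e N (intpart (- a * N%:R))) = fun N => e N (intpart (a * N%:R)))//.
apply/funext => N; rewrite mulNr intpartN.
by apply: (mean_cost_even c0 mX indX identF identB); exact: intpart_walk.
Qed.

(** A walk of slope [a] up to time about [t N] is followed by one of slope [b]. The endpoint reached
    is only close to [N] times the mixed slope, hence the hypothesis on arbitrary endpoints with the
    right asymptotic slope. *)
Lemma profile_concave a b t :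
  (forall y, (forall N, `|y N| <= N%:Z) -> `|t * a + (1 - t) * b| < 1 ->
     grows_like (fun N => (y N)%:~R) (t * a + (1 - t) * b) ->
     grows_like (fun N => e N (y N)) (- Lam (t * a + (1 - t) * b))) ->
  `|a| <= 1 -> `|b| <= 1 -> 0 <= t <= 1 ->
  t * Lam a + (1 - t) * Lam b <= Lam (t * a + (1 - t) * b).
Proof.
move=> rate a1 b1 /andP[t0 t1].
have [->|tn0] := eqVneq t 0; first by rewrite subr0 !mul0r !mul1r !add0r.
have [->|tn1] := eqVneq t 1; first by rewrite subrr !mul0r !mul1r !addr0.
(* Once the trivial cases are removed, the mixture lies in the open interval, where the rate is
   known for all such endpoints. *)
have [->|ab] := eqVneq a b; first by rewrite -!mulrDl addrC subrK !mul1r.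
have {tn0}t0 : 0 < t by rewrite lt_neqAle eq_sym tn0.
have {tn1}t1 : t < 1 by rewrite lt_neqAle tn1.
set x := t * a + _ in rate *.
have x1 : `|x| < 1.
  move: a1 b1; rewrite !ler_norml ltr_norml => /andP[a1 a2] /andP[b1 b2].
  have := mulr_gt0 t0 (_ : 0 < 1 - t); rewrite subr_gt0 => /(_ t1) tt.
  move: ab; rewrite neq_lt => /orP[] ab; rewrite /x; apply/andP; split; nra.
pose n1 (N : nat) := Num.truncn (t * N%:R).
have tN (N : nat) : 0 <= t * N%:R by rewrite mulr_ge0// ltW.
have n1b (N : nat) : (n1 N)%:R <= t * N%:R /\ t * N%:R < (n1 N)%:R + 1.
  by have /andP[h1 h2] := truncn_itv (tN N); rewrite natr1.
have n1N (N : nat) : (n1 N <= N)%N.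
  rewrite -(ler_nat R); apply: (le_trans (n1b N).1); by rewrite ler_piMl// ltW.
pose y N := intpart (a * (n1 N)%:R) + intpart (b * (N - n1 N)%:R).
have ya N := intpart_walk (n1 N) a1; have yb N := intpart_walk (N - n1 N) b1.
have yN N : `|y N| <= N%:Z.
  by rewrite (le_trans (ler_normD _ _))// (le_trans (lerD (ya N) (yb N)))// -PoszD subnKC.
have yx : grows_like (fun N => (y N)%:~R) x.
  apply: (@grows_like_near _ (fun N => x * N%:R) _ _ 4).
    by move=> eps eps0; exists 0%N => n _; rewrite subrr normr0 mulr_ge0// ltW.
  move=> N; rewrite /y intrD.
  have -> : (intpart (a * (n1 N)%:R))%:~R + (intpart (b * (N - n1 N)%:R))%:~R - x * N%:R =
    ((intpart (a * (n1 N)%:R))%:~R - a * (n1 N)%:R) +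
    ((intpart (b * (N - n1 N)%:R))%:~R - b * (N - n1 N)%:R) +
    (a - b) * ((n1 N)%:R - t * N%:R) :> R by rewrite natrB// /x; ring.
  have := (intpart_bounds (a * (n1 N)%:R)).1; have := (intpart_bounds (b * (N - n1 N)%:R)).1.
  move=> h1 h2; apply: (le_trans (ler_normD _ _)).
  have h3 : `|(a - b) * ((n1 N)%:R - t * N%:R)| <= 2 * 1.
    rewrite normrM ler_pM//; first by rewrite (le_trans (ler_normB _ _))//; lra.
    by have [h3 h4] := n1b N; rewrite distrC ger0_norm; lra.
  have := ler_normD ((intpart (a * (n1 N)%:R))%:~R - a * (n1 N)%:R : R)
    ((intpart (b * (N - n1 N)%:R))%:~R - b * (N - n1 N)%:R); lra.
apply/ler_addgt0Pr => eps eps0.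
have e2 : 0 < eps / 2 by rewrite divr_gt0.
have [Ca CaP] := grows_like_affine (mean_rate a1) e2.
have [Cb CbP] := grows_like_affine (mean_rate b1) e2.
have [Cx CxP] := grows_like_affine (rate y yN x1 yx) e2.
rewrite -subr_le0; apply: (@le0_of_bounded_multiples _ _ (Ca + Cb + Cx + `|Lam a - Lam b|)) => N _.
have := mean_cost_subadditive c0 mX indX identF identB (ya N) (yb N).
rewrite subnKC// -/e -/(y N).
have := CaP (n1 N); have := CbP (N - n1 N)%N; have := CxP N.
rewrite !ler_norml natrB// => /andP[h1 h2] /andP[h3 h4] /andP[h5 h6] sub.
have h7 : (Lam a - Lam b) * (t * N%:R - (n1 N)%:R) <= `|Lam a - Lam b|.
  rewrite (le_trans (ler_norm _))// normrM ler_piMr//.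
  by have [h7 h8] := n1b N; rewrite ger0_norm; lra.
by lra.
Qed.

Lemma profile_le a th q : `|a| <= 1 -> 0 < th -> th * c <= 1 / 2 -> 0 <= q ->
  Lam a <= (q * (1 - a) + (2 * expR (- q) + 2 * (th * c) ^+ 2)) / th.
Proof.
move=> a1 th0 thc q0; apply/ler_addgt0Pr => eps eps0.
have [C CP] := grows_like_affine (mean_rate a1) eps0.
rewrite -subr_le0; apply: (@le0_of_bounded_multiples _ _ (C + q / th)) => N _.
have aN := intpart_walk N a1.
have := mean_cost_lower c0 mX indX symB th0 thc q0 aN.
have := CP N; have := (intpart_bounds (a * N%:R)).1; rewrite -/e.
rewrite !ler_norml => /andP[h1 h2] /andP[h3 h4] h5.
have : (q * (N%:R - (intpart (a * N%:R))%:~R) +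
   N%:R * (2 * expR (- q) + 2 * (th * c) ^+ 2)) / th <=
   ((q * (1 - a) + (2 * expR (- q) + 2 * (th * c) ^+ 2)) * N%:R + q) / th.
  rewrite ler_pM2r ?invr_gt0//.
  have : q * (N%:R - (intpart (a * N%:R))%:~R) <= q * ((1 - a) * N%:R + 1).
    by rewrite ler_wpM2l//; lra.
  by lra.
move: h5; rewrite mulNr.
move: ((q * (N%:R - _) + _) / th) => z h5; rewrite mulrDl mulrAC.
move: (_ / th) (q / th) => v w h6; lra.
Qed.

End Profile.

Lemma shape_function : exists Lam : R -> R,
  [/\ (forall a, `|a| < 1 -> forall eps : R, 0 < eps ->
         exists2 r : R, 0 < r & forall a', `|a' - a| < r -> `|Lam a' - Lam a| <= eps),
      (forall eps : R, 0 < eps ->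
         exists2 r : R, 0 < r & forall a, 1 - r < a -> a <= 1 -> `|Lam a - Lam 1| <= eps),
      (forall a, `|a| <= 1 -> Lam (- a) = Lam a),
      (forall a b t, `|a| <= 1 -> `|b| <= 1 -> 0 <= t <= 1 ->
         t * Lam a + (1 - t) * Lam b <= Lam (t * a + (1 - t) * b)) &
      (forall a, `|a| <= 1 -> 0 <= Lam a)] /\
  {ae P, forall u, forall a, `|a| <= 1 ->
     grows_like (fun N => env_cost c N (intpart (a * N%:R)) (joint X u)) (- Lam a)}.
Proof.
pose admissible (p : nat * int) := [/\ (0 < p.1)%N, `|p.2| <= p.1%:Z & p.2 != 0].
have /choice[h hP] (p : nat * int) : exists g, admissible p ->
    grows_like (fun k => e (k * p.1) (k%:Z * p.2)) g /\
    {ae P, forall u, grows_like (fun k => env_cost c (k * p.1) (k%:Z * p.2) (joint X u)) g}.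
  have [[p0 p1 p2]|np] := pselect (admissible p); last by exists 0.
  by have [g gP] := direction_ergodic c0 mX indX identF identB p0 p1 p2; exists g.
have env_rates : {ae P, forall u, forall p, admissible p ->
    grows_like (fun k => env_cost c (k * p.1) (k%:Z * p.2) (joint X u)) (h p)}.
  apply: ae_forall_countable => p; have [ap|nap] := pselect (admissible p).
    by have [_] := hP p ap; apply: filterS => u hu _.
  by apply: aeW => u /nap.
pose rate n m := h (n, m).
have mean_ext := mean_cost_extendable c0 P mX.
have mean_has : has_rates e rate.
  by move=> n m n0 mn m0; exact: (hP (n, m) (And3 n0 (ltW mn) m0)).1.
have [L [Lrate Lcont]] := directional_rate (ltW c0) mean_ext mean_has.
have diag_mean N : e N (intpart (1 * N%:R : R)) = 0.
  rewrite mul1r -[N%:R]/(N%:Z%:~R) intpart_int.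
  exact: (mean_cost_diag c0 mX indX symB).
have antidiag_mean N : e N (intpart (- 1 * N%:R : R)) = 0.
  rewrite mulN1r intpartN -[N%:R]/(N%:Z%:~R) intpart_int.
  rewrite /e (mean_cost_even c0 mX indX identF identB) ?ger0_norm//.
  exact: (mean_cost_diag c0 mX indX symB).
have zero_rate (f : nat -> R) : (forall N, f N = 0) -> grows_like f 0.
  by move=> f0 eps eps0; exists 0%N => n _; rewrite f0 mul0r subr0 normr0 mulr_ge0// ltW.
have end_cases (a : R) : `|a| <= 1 -> [\/ `|a| < 1, a = 1 | a = - 1].
  rewrite le_eqVlt => /orP[/eqP a1|a1]; last by constructor 1.
  by have [a0|a0] := leP 0 a; [constructor 2; rewrite -a1 ger0_norm
                              |constructor 3; rewrite -a1 ltr0_norm// opprK].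
pose Lam a : R := if `|a| < 1 then - L a else 0.
have Lam_in a : `|a| < 1 -> Lam a = - L a by rewrite /Lam => ->.
have Lam1 : Lam 1 = 0 by rewrite /Lam normr1 ltxx.
have LamN1 : Lam (- 1) = 0 by rewrite /Lam normrN1 ltxx.
have mean_rate (a : R) : `|a| <= 1 -> grows_like (fun N => e N (intpart (a * N%:R))) (- Lam a).
  move=> a1; have [a1'|->|->] := end_cases a a1.
  - rewrite Lam_in// opprK.
    apply: (Lrate e (fun N => intpart (a * N%:R)) a) => //; last exact: grows_like_intpart.
    by move=> N; exact: intpart_walk.
  - by rewrite Lam1 oppr0; apply: zero_rate.
  - by rewrite LamN1 oppr0; apply: zero_rate.
have concave (a b t : R) : `|a| <= 1 -> `|b| <= 1 -> 0 <= t <= 1 ->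
    t * Lam a + (1 - t) * Lam b <= Lam (t * a + (1 - t) * b).
  apply: (profile_concave mean_rate) => y yN x1 yx; rewrite Lam_in// opprK.
  exact: (Lrate e y).
have even := profile_even mean_rate.
(* [a] is a mixture of 1 and -1, where [Lam] vanishes, so the sign follows from concavity. *)
have nonneg (a : R) : `|a| <= 1 -> 0 <= Lam a.
  move=> a1; have := concave 1 (- 1) ((1 + a) / 2); rewrite normrN normr1 lexx Lam1 LamN1.
  have -> : (1 + a) / 2 * 1 + (1 - (1 + a) / 2) * - 1 = a by field.
  by rewrite !mulr0 addr0; apply=> //; move: a1; rewrite ler_norml => /andP[? ?];
     apply/andP; split; lra.
exists Lam; split; first split => //.
- move=> a a1 eps eps0; have [r r0 rP] := Lcont a a1 eps eps0.
  exists (Num.min r (1 - `|a|)); first by rewrite lt_min r0 subr_gt0.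
  move=> a'; rewrite lt_min => /andP[/rP h1 h2].
  have a'1 : `|a'| < 1.
    have : `|a'| <= `|a' - a| + `|a| by rewrite -{1}(subrK a a') ler_normD.
    by lra.
  by rewrite (Lam_in _ a'1) (Lam_in _ a1) -opprD normrN.
- move=> eps eps0; rewrite Lam1.
  have cp : 0 < 12 * c ^+ 2 by rewrite mulr_gt0// exprn_gt0.
  (* Of the three terms in [profile_le], [th] makes the last at most [eps / 6 * th], [q] makes
     [2 expR (- q) <= 2 / q = eps / 3 * th], and the radius keeps [q (1 - a)] below
     [eps / 3 * th]. *)
  pose th := Num.min ((1 / 2) / c) (eps / (12 * c ^+ 2)).
  have th0 : 0 < th by rewrite lt_min !divr_gt0.
  have thc : th * c <= 1 / 2 by rewrite -ler_pdivlMr// ge_min lexx.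
  have thc2 : 2 * (th * c) ^+ 2 <= eps / 6 * th.
    have : th * (12 * c ^+ 2) <= eps by rewrite -ler_pdivlMr// ge_min lexx orbT.
    by move=> /(ler_wpM2l (ltW th0)); rewrite exprMn; lra.
  pose q := 6 / (th * eps).
  have q0 : 0 < q by rewrite divr_gt0// mulr_gt0.
  have qE : 2 * expR (- q) <= eps / 3 * th.
    have : expR (- q) <= q^-1.
      rewrite expRN lef_pV2 ?posrE ?expR_gt0// (le_trans _ (expR_ge1Dx q))//.
      by rewrite lerDr.
    by rewrite /q invf_div; lra.
  exists (eps / 3 * th / q); first by rewrite !divr_gt0 ?mulr_gt0 ?divr_gt0.
  (* A large radius lets [a] fall below -1, where [Lam] is 0 by definition. *)
  move=> a a1 a2; have an : `|a| <= 1 \/ a < - 1.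
    by have [a3|a3] := leP (- 1) a; [left; rewrite ler_norml a3 a2 | right].
  have [{}an|am1] := an; last first.
    have na : ~~ (`|a| < 1) by rewrite -leNgt ltr0_norm; lra.
    by rewrite /Lam (negbTE na) subr0 normr0 ltW.
  rewrite subr0 (ger0_norm (nonneg _ an)).
  apply: (le_trans (profile_le mean_rate an th0 thc (ltW q0))).
  rewrite ler_pdivrMr//.
  have : q * (1 - a) <= eps / 3 * th.
    by rewrite mulrC -ler_pdivlMr//; lra.
  by have := mulr_gt0 eps0 th0; lra.
move: env_rates; apply: filterS => u env_rates a a1.
have [a1'|->|->] := end_cases a a1.
- rewrite Lam_in// opprK.
  apply: (Lrate (fun n x => env_cost c n x (joint X u)) (fun N => intpart (a * N%:R)) a) => //.
  + exact: env_cost_extendable.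
  + by move=> n m n0 mn m0; exact: (env_rates (n, m) (And3 n0 (ltW mn) m0)).
  + by move=> N; exact: intpart_walk.
  + exact: grows_like_intpart.
- have ad : admissible (1%N, 1) by [].
  have h0 : h (1%N, 1) = 0.
    apply: grows_like_unique (hP _ ad).1 _; apply: zero_rate => N.
    by have := diag_mean N; rewrite mul1r -[N%:R]/(N%:Z%:~R) intpart_int /= muln1 mulr1.
  rewrite Lam1 oppr0; have := env_rates _ ad; rewrite h0.
  congr grows_like; apply/funext => N /=.
  by rewrite mul1r -[N%:R]/(N%:Z%:~R) intpart_int muln1 mulr1.
- have ad : admissible (1%N, - 1) by [].
  have h0 : h (1%N, - 1) = 0.
    apply: grows_like_unique (hP _ ad).1 _; apply: zero_rate => N.
    have := antidiag_mean N; rewrite mulN1r intpartN -[N%:R]/(N%:Z%:~R) intpart_int.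
    by rewrite /= muln1 mulrN1.
  rewrite LamN1 oppr0; have := env_rates _ ad; rewrite h0.
  congr grows_like; apply/funext => N /=.
  by rewrite mulN1r intpartN -[N%:R]/(N%:Z%:~R) intpart_int muln1 mulrN1.
Qed.

End Shape.

(** The atoms at 1 and -1 already carry the total mass 1, so the rest is null and the law is known
    on every measurable set; equality in law and symmetry of the coins both follow. *)
Lemma coin_law {d} {T : measurableType d} {R : realType} (P : probability T R) (f : T -> R) :
  measurable_fun setT f ->
  P (f @^-1` [set 1]) = (1 / 2)%:E -> P (f @^-1` [set -1]) = (1 / 2)%:E ->
  {ae P, forall u, f u = 1 \/ f u = -1} /\
  (forall A, measurable A -> P (f @^-1` A) =
    ((if 1%R \in A then (1 / 2)%:E else 0) + (if (-1)%R \in A then (1 / 2)%:E else 0))%E).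
Proof.
move=> mf p1 pN1.
have mpre A : measurable A -> measurable (f @^-1` A).
  by move=> mA; rewrite -[X in measurable X]setTI; exact: mf.
set U1 := f @^-1` [set 1] in p1; set U2 := f @^-1` [set -1] in pN1.
have mU1 : measurable U1 by exact: mpre.
have mU2 : measurable U2 by exact: mpre.
have U12 : U1 `&` U2 = set0.
  by rewrite -subset0 => u [f1 f2]; have : f u = -1 := f2; rewrite (f1 : f u = 1); lra.
have null : P (~` (U1 `|` U2)) = 0%E.
  have PU : P (U1 `|` U2) = (P U1 + P U2)%E by rewrite measureU.
  have half : 1 / 2 + 1 / 2 = 1 :> R by lra.
  move: PU; rewrite p1 pN1 -EFinD half => PU.
  by rewrite probability_setC ?PU ?subee//; exact: measurableU.
split.
  by exists (~` (U1 `|` U2)); split => //; exact/measurableC/measurableU.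
move=> A mA; set E := f @^-1` A; have mE : measurable E by exact: mpre.
have part (V : set T) (s : R) : V = f @^-1` [set s] -> P V = (1 / 2)%:E ->
    P (E `&` V) = (if s \in A then (1 / 2)%:E else 0)%E.
  move=> VE PV; case: ifPn => [/set_mem sA|/negP sA].
    by rewrite -PV; congr (P _); apply/seteqP; split => u; [case|];
       rewrite VE /E /= => // ->.
  rewrite (_ : E `&` V = set0) ?measure0// -subset0 => u [].
  by rewrite VE /E /= => Au fu; apply: sA; rewrite -fu inE.
rewrite -(part U1 1)// -(part U2 (-1))// -measureU//; last 3 first.
- exact: measurableI.
- exact: measurableI.
- by rewrite setIACA U12 setI0.
rewrite -setIUr; apply/eqP; rewrite eq_le.
have mU : measurable (U1 `|` U2) by exact: measurableU.
have mEU : measurable (E `&` (U1 `|` U2)) by exact: measurableI.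
have mUC : measurable (~` (U1 `|` U2)) by exact: measurableC.
apply/andP; split; last by apply: le_measure; rewrite ?inE//; exact: subIsetl.
apply: (@le_trans _ _ (P (E `&` (U1 `|` U2)) + P (~` (U1 `|` U2)))%E).
  apply: le_trans (measureU2 _ mEU mUC).
  apply: le_measure; rewrite ?inE//; first exact: measurableU.
  by move=> u Eu; case: (pselect ((U1 `|` U2) u)) => h; [left|right].
by rewrite null adde0.
Qed.

Unset Implicit Arguments.
Set Strict Implicit.

Theorem theorem2p1 (R : realType) (c q kappa : R) (rho : R -> R)
  (d : measure_display) (T : measurableType d) (P : probability T R)
  (F B : int -> T -> R) :
  0 < c -> 0 < q -> -1 < kappa ->
  (* density rho: even, continuous and positive on (-c,c), zero outside *)
  (forall x, rho (- x) = rho x) ->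
  {in `]-c, c[, continuous rho} ->
  (forall x, x \in `]-c, c[ -> 0 < rho x) ->
  (forall x, x \notin `]-c, c[ -> rho x = 0) ->
  (fun x => rho x / (`|c - x| `^ kappa)) @ c^'- --> q ->
  (* F(x) has density rho, B(i) is a fair +-1 coin *)
  (forall x, measurable_fun setT (F x)) ->
  (forall i, measurable_fun setT (B i)) ->
  (forall x (A : set R), measurable A ->
     P ((F x) @^-1` A) = (\int[lebesgue_measure]_(y in A) (rho y)%:E)%E) ->
  (forall i, P ((B i) @^-1` [set 1]) = (1 / 2)%:E /\
             P ((B i) @^-1` [set -1]) = (1 / 2)%:E) ->
  (* all the F(x), B(i) are mutually independent *)
  mutually_independent P (FB_family F B) ->
  exists Lambda : R -> R,
    {within `[-1, 1], continuous Lambda} /\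
    (forall a, a \in `[-1, 1] -> Lambda (- a) = Lambda a) /\
    (forall a b t, a \in `[-1, 1] -> b \in `[-1, 1] -> t \in `[0, 1] ->
       t * Lambda a + (1 - t) * Lambda b <= Lambda (t * a + (1 - t) * b)) /\
    (forall a, a \in `[-1, 1] -> 0 <= Lambda a) /\
    exists Omega0 : set T, measurable Omega0 /\ P Omega0 = 1%E /\
      forall w, Omega0 w -> forall alpha, alpha \in `[-1, 1] ->
        (fun n : nat => Abar (fun i => B i w) (fun x => F x w) n
                          (intpart (alpha * n%:R)) / n%:R)
          @ \oo --> - Lambda alpha.
Proof.
move=> c0 _ _ _ _ _ rho0 _ mF mB lawF lawB ind.
pose X := FB_family F B.
have mX k : measurable_fun setT (X k) by case: k.
have coin i := coin_law (mB i) (lawB i).1 (lawB i).2.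
have identF x y A : measurable A -> P (X (inl x) @^-1` A) = P (X (inl y) @^-1` A).
  by move=> mA; rewrite /X /= !lawF.
have identB i j A : measurable A -> P (X (inr i) @^-1` A) = P (X (inr j) @^-1` A).
  by move=> mA; rewrite /X /= (coin i).2// (coin j).2.
have symB i (A : set R) : measurable A ->
    P (X (inr i) @^-1` ((fun r => - r) @^-1` A)) = P (X (inr i) @^-1` A).
  move=> mA; rewrite /X /= (coin i).2 ?(coin i).2//; last first.
    have mN : measurable_fun setT (fun r : R => - r) by exact: measurable_funN.
    by rewrite -[X in measurable X]setTI; exact: mN.
  rewrite addeC; congr (_ + _)%E; congr (if _ then _ else _); apply/idP/idP;
  by rewrite !inE /= ?opprK.
have [Lam [[Lam_in Lam_end even concave nonneg] shape]] :=
  shape_function c0 mX ind identF identB symB.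
have ae_F : {ae P, forall u, forall x, `|F x u| <= c}.
  apply: ae_forall_countable => x.
  exists (F x @^-1` (~` `[-c, c])); split.
  - by rewrite -[X in measurable X]setTI; apply: mF => //; exact: measurableC.
  - rewrite lawF; last exact: measurableC.
    apply: integral0_eq => y /= yc; rewrite rho0//.
    apply/negP => yc'; apply: yc; move: yc'; rewrite !in_itv/= => /andP[h1 h2].
    by rewrite !ltW.
  - by move=> u /= h; rewrite in_itv /= -ler_norml.
have ae_B : {ae P, forall u, forall i, B i u = 1 \/ B i u = -1}.
  by apply: ae_forall_countable => i; exact: (coin i).1.
have in1 (a : R) : a \in `[-1, 1] -> `|a| <= 1 by rewrite in_itv /= ler_norml.
exists Lam; split.
  have lt11 : -1 < 1 :> R by lra.
  apply/(continuous_within_itvP _ lt11); split.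
  - move=> a; rewrite in_itv /= -ltr_norml => a1.
    apply/cvgrPdist_le => eps eps0; have [r r0 rP] := Lam_in a a1 eps eps0.
    apply/nbhs_ballP; exists r => //= a'; rewrite /ball /= distrC => /rP.
    by rewrite distrC.
  - apply/cvgrPdist_le => eps eps0; have [r r0 rP] := Lam_end eps eps0.
    near=> a.
    have a0 : -1 < a by near: a; exact: nbhs_right_gt.
    have a1 : a < 1 by near: a; exact: nbhs_right_lt.
    have ar : a < -1 + r by near: a; apply: nbhs_right_lt; lra.
    have an : `|a| <= 1 by rewrite ler_norml !ltW.
    rewrite (even 1) ?normr1// -(even a an) distrC.
    by apply: rP; lra.
  - apply/cvgrPdist_le => eps eps0; have [r r0 rP] := Lam_end eps eps0.
    near=> a.
    have a1 : a < 1 by near: a; exact: nbhs_left_lt.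
    have ar : 1 - r < a by near: a; apply: nbhs_left_gt; lra.
    by rewrite distrC; apply: rP => //; exact: ltW.
split; first by move=> a /in1; exact: even.
split; first by move=> a b t /in1 a1 /in1 b1; rewrite in_itv /= => t1; exact: concave.
split; first by move=> a /in1; exact: nonneg.
have [N [mN N0 NP]] : {ae P, forall u, [/\ forall x, `|F x u| <= c,
    forall i, B i u = 1 \/ B i u = -1 & forall a, `|a| <= 1 ->
      grows_like (fun N => env_cost c N (intpart (a * N%:R)) (joint X u)) (- Lam a)]}.
  by move: ae_F ae_B shape; apply: filterS3 => u.
exists (~` N); split; first exact: measurableC.
split; first by rewrite probability_setC// N0 sube0.
move=> u Nu a /in1 a1.
have [Fu Bu uP] : [/\ forall x, `|F x u| <= c, forall i, B i u = 1 \/ B i u = -1 &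
    forall a, `|a| <= 1 ->
      grows_like (fun N => env_cost c N (intpart (a * N%:R)) (joint X u)) (- Lam a)].
  by apply: contrapT => h; apply: Nu; exact: NP.
apply/grows_like_cvg; have := uP a a1.
have -> : (fun N => env_cost c N (intpart (a * N%:R)) (joint X u)) =
  (fun n => Abar (fun i => B i u) (fun x => F x u) n (intpart (a * n%:R))) => //.
apply/funext => n; rewrite /env_cost /Abar /min_cost; congr inf; apply: eq_imagel => g _.
(* Since [|B i| = 1], the product is at most [c] in absolute value and the truncation is the
   identity. *)
apply: eq_bigr => i _; rewrite /env_field /joint /X /= truncate_id//.
by have [->|->] := Bu i%:Z; rewrite ?mul1r ?mulN1r ?normrN.
Unshelve. all: by end_near.
Qed.
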